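(* Let $\Gamma=\langle a,b\rangle$ be the free group on $a,b$ and let $\mathcal{G}=(V,E)$ be its Cayley graph relative to $\{a,b\}$, with $V=\Gamma$. Let $X=\{a,b\}^\Gamma$, with the shift action $(\gamma\cdot x)_\eta=x_{\gamma^{-1}\eta}$, and $\mathbb{P}=\left(\frac12\delta_a+\frac12\delta_b\right)^{\otimes\Gamma}$. Let $\pi:X\to\{0,1\}^E$ be the $\Gamma$-equivariant map defined as follows: for each $\gamma\in\Gamma$, among the two edges $\{\gamma,\gamma a\}$ and $\{\gamma,\gamma b\}$, the edge $\{\gamma,\gamma x_\gamma\}$ is open (label 1) in $\pi(x)$ and the other one is closed (label 0). Then the generalized percolation given by $\Gamma\curvearrowright(X,\mathbb{P})$ and $\pi$ satisfies the Indistinguishability Property but does not satisfy the Strong Indistinguishability Property.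
   Context: The Cayley graph $\mathcal{G}$ has an edge between $\gamma$ and $\gamma s$ for each $\gamma\in\Gamma$, $s\in\{a,b\}$, and $\Gamma$ acts on it by left multiplication. Each $\omega\in\{0,1\}^E$ is viewed as the subgraph with vertex set $V$ and edge set $\omega^{-1}(\{1\})$; its connected components are its clusters, and $u\overset{\omega}{\longleftrightarrow}v$ means that $u,v$ are in the same cluster of $\omega$. A generalized percolation is a measure-preserving Borel action $\Gamma\curvearrowright(X,\mathbb{P})$ on an atomless standard probability space together with a $\Gamma$-equivariant Borel map $\pi:X\to\{0,1\}^E$ (with the shift action on $\{0,1\}^E$). Let $V_\infty^\pi(x)$ be the set of vertices belonging to an infinite cluster of $\pi(x)$. A (vertex) property is a Borel function $P:X\times V\to\{\text{true},\text{false}\}$ invariant under the diagonal action of $\Gamma$. It is a cluster property if $P(x,u)\Leftrightarrow P(x,v)$ whenever $u\overset{\pi(x)}{\longleftrightarrow}v$. For $W\subset V$, $P^\pm(x,W)$ means: either $P(x,v)$ holds for all $v\in W$, or $P(x,v)$ fails for all $v\in W$. Indistinguishability Property: for every cluster property $P$, $\mathbb{P}[P^\pm(x,V_\infty^\pi(x))]=1$. A rerooting is a Borel map $\alpha:X\times V\to V$, $(x,v)\mapsto u^\alpha_{x,v}$, $\Gamma$-equivariant for the diagonal action on $X\times V$, with $u^\alpha_{x,v}\overset{\pi(x)}{\longleftrightarrow}v$ for all $(x,v)$. A sequence $(P_n)$ of vertex properties is a $\mathbb{P}$-asymptotic cluster property if for every rerooting $\alpha$ and every $v\in V$, $\mathbb{P}[\{x: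 P_n(x,v)\Leftrightarrow P_n(x,u^\alpha_{x,v})\}]\to1$ as $n\to\infty$. Strong Indistinguishability Property: for every $\mathbb{P}$-asymptotic cluster property $(P_n)$ and every finite $F\subset V$, $\mathbb{P}[P_n^\pm(x,V_\infty^\pi(x)\cap F)]\to1$ as $n\to\infty$. *)

(* Defs.v *)
From HB Require Import structures.
From mathcomp Require Import all_boot all_order all_algebra.
From mathcomp Require Import all_classical all_reals all_analysis.

Set Implicit Arguments.
Unset Strict Implicit.
Unset Printing Implicit Defensive.

Import Order.TTheory GRing.Theory Num.Theory.

Local Open Scope classical_set_scope.
Local Open Scope group_scope.

(* [(s, true)] stands for the letter [s], [(s, false)] for its inverse. *)
Definition linv (S : Type) (l : S * bool) : S * bool := (l.1, ~~ l.2).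

Definition reduced (S : eqType) (w : seq (S * bool)) : bool :=
  sorted (fun l m => m != linv l) w.

Definition cons_red (S : eqType) (l : S * bool) (w : seq (S * bool)) :=
  if w is m :: w' then if m == linv l then w' else l :: w else [:: l].

Section FreeGroupWords.
Variable S : eqType.
Implicit Types (l m : S * bool) (u v w : seq (S * bool)).

Lemma linvK : involutive (@linv S).
Proof. by case=> s b; rewrite /linv /= negbK. Qed.

Lemma linv_neq l : linv l != l.
Proof. by case: l => s [] //=; apply/eqP => -[]. Qed.

Lemma reduced_tail l w : reduced (l :: w) -> reduced w.
Proof. by rewrite /reduced /=; exact: path_sorted. Qed.

Lemma reduced_cons_red l w : reduced w -> reduced (cons_red l w).
Proof.
case: w => [//|m w] rw /=; case: ifPn => [_|nml]; first exact: reduced_tail rw.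
by rewrite /reduced /= nml.
Qed.

Lemma cons_redK l w : reduced w -> cons_red l (cons_red (linv l) w) = w.
Proof.
case: w => [|m w] rw /=; first by rewrite eqxx.
rewrite linvK; case: eqP => [ml|_]; last by rewrite /= eqxx.
rewrite {m}ml in rw *; case: w rw => [//|k w] /= /andP[kl _].
by rewrite (negbTE kl).
Qed.

Definition mul_word u v := foldr (@cons_red S) v u.

Lemma reduced_mul_word u v : reduced v -> reduced (mul_word u v).
Proof. by move=> rv; elim: u => //= l u IHu; exact: reduced_cons_red. Qed.

Lemma mul_cons_red l v w : reduced w ->
  mul_word (cons_red l v) w = cons_red l (mul_word v w).
Proof.
case: v => [//|m v] rw /=; case: eqP => [->|//].
by rewrite cons_redK //; exact: reduced_mul_word.
Qed.

Lemma mul_wordA u v w : reduced w ->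
  mul_word u (mul_word v w) = mul_word (mul_word u v) w.
Proof. by move=> rw; elim: u => //= l u ->; rewrite mul_cons_red. Qed.

Lemma mul_word1 u : reduced u -> mul_word u [::] = u.
Proof.
elim: u => //= l [//|m u] IHu ru; rewrite IHu ?(reduced_tail ru) //=.
by case/andP: ru => /negbTE ->.
Qed.

Definition inv_word u := rev (map (@linv S) u).

Lemma inv_wordK : involutive inv_word.
Proof. by move=> u; rewrite /inv_word map_rev revK (mapK linvK). Qed.

Lemma reduced_inv_word u : reduced u -> reduced (inv_word u).
Proof.
rewrite /reduced /inv_word rev_sorted sorted_map; apply: sub_sorted => l m /=.
by rewrite linvK eq_sym (can2_eq linvK linvK).
Qed.

Lemma mul_wordV u : mul_word u (inv_word u) = [::].
Proof.
suff E v : mul_word u (inv_word u ++ v) = v by rewrite -[inv_word u]cats0 E.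
elim: u v => //= l u IHu v.
by rewrite /inv_word /= rev_cons cat_rcons IHu /= eqxx.
Qed.

End FreeGroupWords.

Record free_group (S : eqType) := FreeGroup {
  word :> seq (S * bool);
  wordP : reduced word
}.

Section FreeGroup.
Variable S : choiceType.

HB.instance Definition _ := [isSub for @word S].
HB.instance Definition _ := [Choice of free_group S by <:].

Definition fg_one : free_group S := @FreeGroup S [::] isT.
Definition fg_mul (x y : free_group S) : free_group S :=
  FreeGroup (reduced_mul_word x (wordP y)).
Definition fg_inv (x : free_group S) : free_group S :=
  FreeGroup (reduced_inv_word (wordP x)).

Lemma fg_mulA : associative fg_mul.
Proof. by move=> x y z; apply: val_inj; rewrite /= mul_wordA // wordP. Qed.

Lemma fg_mul1 : left_id fg_one fg_mul.
Proof. by move=> x; exact: val_inj. Qed.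

Lemma fg_mulr1 : right_id fg_one fg_mul.
Proof. by move=> x; apply: val_inj; rewrite /= mul_word1 // wordP. Qed.

Lemma fg_mulrV : right_inverse fg_one fg_inv fg_mul.
Proof. by move=> x; apply: val_inj; rewrite /= mul_wordV. Qed.

Lemma fg_mulVr : left_inverse fg_one fg_inv fg_mul.
Proof.
move=> x; rewrite -{2}[x](_ : fg_inv (fg_inv x) = x) ?fg_mulrV //.
by apply: val_inj; rewrite /= inv_wordK.
Qed.

HB.instance Definition _ :=
  isGroup.Build (free_group S) fg_mulA fg_mul1 fg_mulr1 fg_mulVr fg_mulrV.

Definition fg_gen (s : S) : free_group S := @FreeGroup S [:: (s, true)] isT.

HB.instance Definition _ := isPointed.Build (free_group S) 1.
HB.instance Definition _ := @isMeasurable.Build default_measure_display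
  (free_group S) discrete_measurable discrete_measurable0
  discrete_measurableC discrete_measurableU.

End FreeGroup.

Variant letter := La | Lb.

Definition bool_of_letter (s : letter) : bool := if s is La then true else false.
Definition letter_of_bool (b : bool) : letter := if b then La else Lb.
Lemma bool_of_letterK : cancel bool_of_letter letter_of_bool.
Proof. by case. Qed.

HB.instance Definition _ := Finite.copy letter (can_type bool_of_letterK).
HB.instance Definition _ := isPointed.Build letter La.
HB.instance Definition _ := @isMeasurable.Build default_measure_display
  letter discrete_measurable discrete_measurable0
  discrete_measurableC discrete_measurableU.

Definition F2 := free_group letter.
Definition gen : letter -> F2 := @fg_gen letter.

(* The pair [(g, s)] stands for the undirected edge [{g, g s}]; by
   [edge_ends_inj] below every edge of the Cayley graph is represented
   exactly once. *)
Definition edge : Type := (F2 * letter)%type.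
Definition edge_ends (e : edge) : set F2 := [set e.1; e.1 * gen e.2].

Lemma gen_neq1 (s : letter) : gen s <> 1.
Proof. by move=> /(congr1 (@word _)). Qed.

Lemma gen_mul_neq1 (s t : letter) : gen s * gen t <> 1.
Proof. by move=> /(congr1 (@word _)); case: s; case: t. Qed.

Lemma gen_inj : injective gen.
Proof. by move=> s t [->]. Qed.

Lemma edge_ends_inj : injective edge_ends.
Proof.
move=> [g s] [h t] E.
have gE : edge_ends (h, t) g by rewrite -E; left.
have gsE : edge_ends (h, t) (g * gen s) by rewrite -E; right.
have hE : edge_ends (g, s) h by rewrite E; left.
have mul_eq x u : x = x * u -> u = 1 :> F2.
  by move=> xu; apply: (@mulgI _ x); rewrite mulg1.
move: gE gsE hE; rewrite /edge_ends /= => gE gsE [hg|hg]; subst h.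
  by case: gsE => [/esym/mul_eq/gen_neq1//|/mulgI/gen_inj ->].
case: gE => [/mul_eq/gen_neq1//|].
by rewrite -mulgA => /mul_eq/gen_mul_neq1.
Qed.

Definition coordinate_cylinders (I : Type) d (T : measurableType d) :
    set (set (I -> T)) :=
  \bigcup_i preimage_set_system setT (fun x : I -> T => x i) measurable.

Definition product_space (I : Type) d (T : measurableType d) : Type :=
  g_sigma_algebraType (@coordinate_cylinders I d T).

HB.instance Definition _ (I : Type) d (T : measurableType d) :=
  Measurable.on (product_space I T).

(* Such a [P] is unique, since finite-dimensional cylinders form a pi-system
   generating the product sigma-algebra. *)
Definition is_product_measure (R : realType) (I : eqType) d
    (T : measurableType d) (mu : set T -> \bar R)
    (P : set (product_space I T) -> \bar R) : Prop :=
  forall (F : seq I) (B : I -> set T), uniq F -> (forall i, measurable (B i)) ->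
    P [set x | forall i, i \in F -> B i (x i)] = (\prod_(i <- F) mu (B i))%E.

Definition config_shift d (T : measurableType d) (g : F2) (x : product_space F2 T) :
    product_space F2 T :=
  fun h => x (g^-1 * h).

Definition subgraphs : Type := product_space edge bool.

HB.instance Definition _ := Measurable.on subgraphs.

Definition edge_shift (g : F2) (w : subgraphs) : subgraphs :=
  fun e => w (g^-1 * e.1, e.2).

Definition open_neighbor (w : subgraphs) : rel F2 := fun u v =>
  [exists s, ((v == u * gen s) && w (u, s)) || ((u == v * gen s) && w (v, s))].

Definition same_cluster (w : subgraphs) (u v : F2) : Prop :=
  exists2 p : seq F2, path (open_neighbor w) u p & last u p = v.

Definition cluster_of (w : subgraphs) (v : F2) : set F2 :=
  [set u | same_cluster w v u].

Definition infinite_vertices (w : subgraphs) : set F2 :=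
  [set v | infinite_set (cluster_of w v)].

Section Percolation.
Context (R : realType) (d : measure_display) (X : measurableType d).

(* [f] is a Borel isomorphism onto a Borel subset of the real line. *)
Definition standard_borel : Prop :=
  exists f : X -> R, [/\ measurable_fun setT f, injective f &
    forall A : set X, measurable A -> measurable (f @` A)].

Definition atomless (P : set X -> \bar R) : Prop :=
  forall A, measurable A -> (0 < P A)%E ->
    exists B, [/\ measurable B, B `<=` A & (0 < P B < P A)%E].

Variables (act : F2 -> X -> X) (P : probability X R) (pi : X -> subgraphs).

(* [F2] being countable and discrete, a Borel action is one in which each group
   element acts by a measurable map. *)
Record generalized_percolation : Prop := GeneralizedPercolation {
  gp_standard : standard_borel;
  gp_atomless : atomless P;
  gp_act1 : forall x, act 1 x = x;
  gp_actM : forall g h x, act (g * h) x = act g (act h x);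
  gp_act_measurable : forall g, measurable_fun setT (act g);
  gp_act_preserving : forall g A, measurable A -> P (act g @^-1` A) = P A;
  gp_measurable : measurable_fun setT pi;
  gp_equivariant : forall g x, pi (act g x) = edge_shift g (pi x)
}.

Definition vertex_property (Q : X * F2 -> bool) : Prop :=
  measurable_fun setT Q /\ forall g x v, Q (act g x, g * v) = Q (x, v).

Definition cluster_property (Q : X * F2 -> bool) : Prop :=
  vertex_property Q /\
  forall x u v, same_cluster (pi x) u v -> Q (x, u) = Q (x, v).

Definition constant_on (Q : X * F2 -> bool) (x : X) (W : set F2) : Prop :=
  (forall v, W v -> Q (x, v)) \/ (forall v, W v -> ~~ Q (x, v)).

Definition indistinguishability : Prop :=
  forall Q, cluster_property Q ->
    P [set x | constant_on Q x (infinite_vertices (pi x))] = 1%E.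

Definition rerooting (alpha : X * F2 -> F2) : Prop :=
  [/\ measurable_fun setT alpha,
      forall g x v, alpha (act g x, g * v) = g * alpha (x, v) &
      forall x v, same_cluster (pi x) (alpha (x, v)) v].

Definition asymptotic_cluster_property (Q : nat -> X * F2 -> bool) : Prop :=
  (forall n, vertex_property (Q n)) /\
  forall alpha, rerooting alpha -> forall v,
    P [set x | Q n (x, v) = Q n (x, alpha (x, v))] @[n --> \oo] --> 1%E.

Definition strong_indistinguishability : Prop :=
  forall Q, asymptotic_cluster_property Q ->
  forall F : set F2, finite_set F ->
    P [set x | constant_on (Q n) x (infinite_vertices (pi x) `&` F)]
      @[n --> \oo] --> 1%E.

End Percolation.

Definition letters : Type := product_space F2 letter.

HB.instance Definition _ := Measurable.on letters.

Definition fair_coin (R : realType) (B : set letter) : \bar R :=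
  ((2^-1)%:E * dirac La B + (2^-1)%:E * dirac Lb B)%E.

Definition coin_map (x : letters) : subgraphs := fun e => x e.1 == e.2.

(* Main.v *)
Require Import Defs.
From mathcomp Require Import all_boot all_order all_algebra.
From mathcomp Require Import all_classical all_reals all_analysis.
From mathcomp Require Import measurable_realfun ring lra zify.

(** Every vertex [v] has exactly one outgoing open edge, towards [forward x v].
    Two vertices lie in the same cluster if and only if their forward paths
    merge, and all clusters are infinite.

    Indistinguishability. A cluster property [Q] is determined by the function
    [f x = Q (x, 1)], and to be constant on clusters means for [f] to be invariant
    under the step which moves the origin along its outgoing edge. It must be
    shown that this step is ergodic ([invariant_zero_one]). It does not preserve
    [P], because a vertex may have 0, 1 or 2 predecessors; its adjoint is the
    operator [transfer], which sums over the predecessors of the origin. If [f] is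
    invariant and [h] is a mean-zero function of finitely many letters, then
    [E (f h) = E (f (transfer^m h))] for all [m]. After finitely many steps the
    iterate looks only at letters behind the origin, and from then on different
    predecessors look at disjoint sets of letters; by independence the second
    moment of the iterates is constant ([mean_transfer_sqr]). On the other hand
    the iterates are supported on the event that the origin is the [m]-th vertex
    of some forward path, and the backward tree of the origin is a critical
    branching process, which dies out ([mean_alive_le]). Hence [E (f h) = 0]
    ([mean_mul_local_eq0]): [f] is independent of all cylinders, thus of itself.

    Failure of the strong property. Let [majority n] hold at [v] if the letter [a]
    prevails among the first [2 n + 1] letters read along the forward path of
    [v]. Vertices of the same cluster read the same letters once their paths have
    merged, up to a bounded shift of time, so their counts of [a] differ by a
    bounded amount ([majority_merge]), while the binomial law gives vanishing mass
    to windows of bounded length ([window_small]): this is an asymptotic cluster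
    property. But the forward paths of [1] and [a^-1 b] stay in disjoint parts of
    the tree, so the majorities at these two vertices are independent fair coins
    and agree with probability 1/2 for every [n] ([majority_constant]).

    That the configurations form a generalized percolation is checked by encoding
    them as base 3 expansions with a measurable inverse, and by splitting events
    along the letters. *)

Set Implicit Arguments.
Unset Strict Implicit.
Unset Printing Implicit Defensive.

Import Order.TTheory GRing.Theory Num.Theory.
Import numFieldNormedType.Exports.

Local Open Scope classical_set_scope.
Local Open Scope ring_scope.

(** * Product measures *)

Section ProductSpace.
Context (I : eqType) (d : measure_display) (T : measurableType d).

Definition box (F : seq I) (B : I -> set T) : set (product_space I T) :=
  [set x | forall i, i \in F -> B i (x i)].

Lemma measurable_coord (i : I) :
  measurable_fun setT (fun x : product_space I T => x i).
Proof.
by move=> _ B mB; apply: sub_sigma_algebra; exists i => //; exists B.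
Qed.

Lemma measurable_into_product d' (Y : measurableType d')
    (f : Y -> product_space I T) :
  (forall i, measurable_fun setT (fun y => f y i)) -> measurable_fun setT f.
Proof.
move=> mf; apply: (@measurability _ _ Y (product_space I T) setT f
  (@coordinate_cylinders I d T)) => //.
move=> _ [_ [i _ [B mB <-]] <-]; rewrite !setTI.
by rewrite -[X in measurable X]setTI; exact: mf.
Qed.

Lemma box_nil (B : I -> set T) : box [::] B = setT.
Proof. by apply/seteqP; split. Qed.

Lemma box_cons i F (B : I -> set T) :
  box (i :: F) B = [set x | B i (x i)] `&` box F B.
Proof.
apply/seteqP; split=> x /=.
  move=> h; split; first by apply: h; rewrite mem_head.
  by move=> j jF; apply: h; rewrite inE jF orbT.
by case=> h1 h2 j; rewrite inE => /orP[/eqP->//|/h2].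
Qed.

Lemma measurable_box F (B : I -> set T) :
  (forall i, measurable (B i)) -> measurable (box F B).
Proof.
move=> mB; elim: F => [|i F IH]; first by rewrite box_nil.
rewrite box_cons; apply: measurableI => //.
by rewrite -[X in measurable X]setTI; exact: measurable_coord.
Qed.

Lemma boxI F F' (B B' : I -> set T) : exists2 C : I -> set T,
  ((forall i, measurable (B i)) -> (forall i, measurable (B' i)) ->
     forall i, measurable (C i)) &
  box F B `&` box F' B' = box (undup (F ++ F')) C.
Proof.
exists (fun i => (if i \in F then B i else setT) `&`
                 (if i \in F' then B' i else setT)).
  by move=> mB mB' i; apply: measurableI; case: ifP.
apply/seteqP; split=> x /=.
  by move=> [h h'] i _; split; case: ifP => // ?; [exact: h|exact: h'].
move=> h; split=> i iF.
  have := h i; rewrite mem_undup mem_cat iF => /(_ isT) [].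
  by [].
by have := h i; rewrite mem_undup mem_cat iF orbT => /(_ isT) [].
Qed.

(** Boxes form a pi-system generating the product sigma-algebra. *)
Lemma eq_measure_box (R : realType)
    (m1 m2 : {measure set (product_space I T) -> \bar R}) :
  (forall F B, uniq F -> (forall i, measurable (B i)) ->
    m1 (box F B) = m2 (box F B)) ->
  (m1 setT < +oo)%E ->
  forall A, measurable A -> m1 A = m2 A.
Proof.
move=> m12 m1oo; pose G : set (set (product_space I T)) :=
  [set C | exists F B, [/\ uniq F, forall i, measurable (B i) & C = box F B]].
apply: (measure_unique G (fun=> setT)).
- apply/seteqP; split.
    apply: smallest_sub; first exact: smallest_sigma_algebra.
    move=> _ [i _ [B mB <-]]; apply: sub_sigma_algebra.
    exists [:: i], (fun=> B); split=> //.
    by rewrite box_cons box_nil setIT setTI.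
  apply: smallest_sub; first exact: sigma_algebra_measurable.
  by move=> _ [F [B [_ mB ->]]]; exact: measurable_box.
- move=> _ _ [F [B [_ mB ->]]] [F' [B' [_ mB' ->]]].
  have [C mC ->] := boxI F F' B B'.
  by exists (undup (F ++ F')), C; split; [exact: undup_uniq|exact: mC|].
- by move=> _; exists [::], (fun=> setT); split => //; rewrite box_nil.
- by rewrite bigcup_const //; exists 0%N.
- by move=> _ [F [B [uF mB ->]]]; exact: m12.
- by [].
Qed.

Definition relabel (s : I -> I) (t : I -> T -> T) (x : product_space I T) :
  product_space I T := fun i => t i (x (s i)).

Lemma measurable_relabel (s : I -> I) (t : I -> T -> T) :
  (forall i, measurable_fun setT (t i)) -> measurable_fun setT (relabel s t).
Proof.
move=> mt; apply: measurable_into_product => i; apply: measurableT_comp => //.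
exact: measurable_coord.
Qed.

(** Permuting the coordinates and applying to each of them a map that preserves
    [mu] carries boxes to boxes and leaves the product formula unchanged, so
    uniqueness applies to the pushforward. *)
Lemma product_measure_relabel (R : realType) (mu : set T -> \bar R)
    (P : probability (product_space I T) R) (s r : I -> I) (t : I -> T -> T) :
  is_product_measure mu P -> cancel s r ->
  (forall i, measurable_fun setT (t i)) ->
  (forall i B, measurable B -> mu (t i @^-1` B) = mu B) ->
  forall A, measurable A -> P (relabel s t @^-1` A) = P A.
Proof.
move=> hP sK mt mut A mA.
have mphi := measurable_relabel s mt.
pose phi' : {mfun product_space I T >-> product_space I T} :=
  mfun_Sub (mem_set mphi).
suff: pushforward P phi' A = P A by [].
apply: eq_measure_box => //.
move=> F B uF mB; rewrite [RHS](hP F B) //.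
transitivity (P (box (map s F) (fun j => t (r j) @^-1` B (r j)))).
  congr (P _).
  apply/seteqP; split=> x /= h i.
    by move=> /mapP[j jF ->]; rewrite sK; exact: h.
  by move=> iF; have := h (s i) (map_f _ iF); rewrite sK.
rewrite [LHS]hP ?map_inj_uniq //.
- by rewrite big_map; apply: eq_bigr => i _; rewrite sK mut.
- exact: can_inj sK.
- by move=> i; rewrite -[X in measurable X]setTI; exact: mt.
have : (P setT < +oo)%E by rewrite probability_setT ltry.
exact.
Qed.

End ProductSpace.

(** * Means of bounded measurable functions *)

Section Mean.
Context (d : measure_display) (T : measurableType d) (R : realType).
Variable P : probability T R.
Implicit Types (F G : T -> R).

Definition bounded_measurable F :=
  measurable_fun setT F /\ exists M, forall x, `|F x| <= M.

Definition mean F : R := \int[P]_x F x.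

Lemma bounded_measurable_cst (c : R) : bounded_measurable (fun=> c).
Proof. by split; [exact: measurable_cst | exists `|c|]. Qed.

Lemma bounded_measurableD F G : bounded_measurable F -> bounded_measurable G ->
  bounded_measurable (fun x => F x + G x).
Proof.
move=> [mF [M FM]] [mG [N GN]]; split; first exact: measurable_funD.
by exists (M + N) => x; rewrite (le_trans (ler_normD _ _))// lerD.
Qed.

Lemma bounded_measurableM F G : bounded_measurable F -> bounded_measurable G ->
  bounded_measurable (fun x => F x * G x).
Proof.
move=> [mF [M FM]] [mG [N GN]]; split; first exact: measurable_funM.
by exists (M * N) => x; rewrite normrM ler_pM.
Qed.

Lemma bounded_measurableZ (c : R) F : bounded_measurable F ->
  bounded_measurable (fun x => c * F x).
Proof. exact/bounded_measurableM/bounded_measurable_cst. Qed.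

Lemma bounded_measurableB F G : bounded_measurable F -> bounded_measurable G ->
  bounded_measurable (fun x => F x - G x).
Proof.
move=> mF mG; have := bounded_measurableD mF (bounded_measurableZ (-1) mG).
by under eq_fun do rewrite mulN1r.
Qed.

Lemma bounded_measurable_sum (I : Type) (r : seq I) (F : I -> T -> R) :
  (forall i, bounded_measurable (F i)) ->
  bounded_measurable (fun x => \sum_(i <- r) F i x).
Proof.
move=> mF; elim: r => [|i r IH].
  by under eq_fun do rewrite big_nil; exact: bounded_measurable_cst.
by under eq_fun do rewrite big_cons; exact: bounded_measurableD.
Qed.

Lemma bounded_measurable_bool (b : T -> bool) : measurable_fun setT b ->
  bounded_measurable (fun x => (b x)%:R).
Proof.
move=> mb; split; last first.
  by exists 1 => x; case: (b x); rewrite ?normr1 ?normr0.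
have -> : (fun x => (b x)%:R) = \1_(b @^-1` [set true]) :> (T -> R).
  apply/funext => x; rewrite indicE; congr (_%:R); congr nat_of_bool.
  by apply/idP/idP => [bx|]; [rewrite inE|rewrite inE].
apply: measurable_indic.
by rewrite -[X in measurable X]setTI; exact: mb.
Qed.

Lemma bounded_measurable_comp (phi : T -> T) F : measurable_fun setT phi ->
  bounded_measurable F -> bounded_measurable (fun x => F (phi x)).
Proof.
move=> mphi [mF [M FM]]; split; last by exists M.
exact: measurableT_comp.
Qed.

Lemma bounded_measurable_integrable F : bounded_measurable F ->
  P.-integrable setT (EFin \o F).
Proof.
move=> [mF [M FM]]; apply: measurable_bounded_integrable => //.
  by have: (P setT < +oo)%E by rewrite probability_setT ltry.
exists M; split; first exact: num_real.
by move=> N MN x _; exact: (le_trans (FM x) (ltW MN)).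
Qed.
Hint Resolve bounded_measurable_integrable : core.

Lemma meanD F G : bounded_measurable F -> bounded_measurable G ->
  mean (fun x => F x + G x) = mean F + mean G.
Proof. by move=> mF mG; rewrite /mean RintegralD//; auto. Qed.

Lemma meanZ c F : bounded_measurable F -> mean (fun x => c * F x) = c * mean F.
Proof. by move=> mF; rewrite /mean RintegralZl//; auto. Qed.

Lemma mean_cst (c : R) : mean (fun=> c) = c.
Proof.
rewrite /mean Rintegral_cst//; have PT : P setT = 1%E := probability_setT P.
by rewrite [X in fine X]PT mulr1.
Qed.

Lemma meanB F G : bounded_measurable F -> bounded_measurable G ->
  mean (fun x => F x - G x) = mean F - mean G.
Proof. by move=> mF mG; rewrite /mean RintegralB//; auto. Qed.

Lemma le_mean F G : bounded_measurable F -> bounded_measurable G ->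
  (forall x, F x <= G x) -> mean F <= mean G.
Proof. by move=> mF mG FG; apply: le_Rintegral => //; auto. Qed.

Lemma mean_sum (I : Type) (r : seq I) (F : I -> T -> R) :
  (forall i, bounded_measurable (F i)) ->
  mean (fun x => \sum_(i <- r) F i x) = \sum_(i <- r) mean (F i).
Proof.
move=> mF; elim: r => [|i r IH].
  by under eq_fun do rewrite big_nil; rewrite big_nil mean_cst.
under eq_fun do rewrite big_cons.
by rewrite meanD ?big_cons ?IH//; exact: bounded_measurable_sum.
Qed.

Lemma eq_mean F G : F =1 G -> mean F = mean G.
Proof. by move=> FG; congr mean; exact/funext. Qed.

Lemma mean_bool (b : T -> bool) : measurable_fun setT b ->
  P [set x | b x] = (mean (fun x => (b x)%:R))%:E.
Proof.
move=> mb; have mS : measurable [set x | b x].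
  have -> : [set x | b x] = setT `&` b @^-1` [set true] by rewrite setTI.
  exact: mb.
rewrite /mean /Rintegral.
have -> : (fun x => (b x)%:R%:E) = EFin \o \1_[set x | b x] :> (T -> \bar R).
  apply/funext => x /=; rewrite indicE; congr (_%:R%:E); congr nat_of_bool.
  by apply/idP/idP => [bx|]; [rewrite inE|rewrite inE].
by rewrite integral_indic// setIT fineK// fin_num_measure.
Qed.

Lemma mean_comp (phi : T -> T) F : measurable_fun setT phi ->
  (forall A, measurable A -> P (phi @^-1` A) = P A) ->
  bounded_measurable F -> mean (fun x => F (phi x)) = mean F.
Proof.
move=> mphi Pphi mF; rewrite /mean /Rintegral; congr fine.
pose phi' : {mfun T >-> T} := mfun_Sub (mem_set mphi).
transitivity (\int[pushforward P phi']_x (F x)%:E)%E; last first.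
  by apply: eq_measure_integral => A mA _; exact: Pphi.
rewrite integral_pushforward//; first by apply/measurable_EFinP; case: mF.
by apply: bounded_measurable_integrable; exact: bounded_measurable_comp.
Qed.

End Mean.

(** * Symmetries of the coin-flip measure and independence *)

Definition other (s : letter) : letter := if s is La then Lb else La.

Lemma otherK : involutive other. Proof. by case. Qed.

Lemma letter_eq (s t : letter) : (s == t) || (s == other t).
Proof. by case: s; case: t. Qed.

Definition translate (g : F2) : letters -> letters := @config_shift _ letter g.

Definition flip (g : F2) : letters -> letters :=
  relabel id (fun h => if h == g then other else id).

Lemma translateE g x h : translate g x h = x (g^-1 * h)%g.
Proof. by []. Qed.

Lemma translate1 x : translate 1%g x = x.
Proof. by apply/funext => h; rewrite translateE invg1 mul1g. Qed.

Lemma translateM g h x : translate (g * h)%g x = translate g (translate h x).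
Proof. by apply/funext => k; rewrite !translateE invgM mulgA. Qed.

Definition local (V : Type) (S : seq F2) (F : letters -> V) :=
  forall x y : letters, {in S, x =1 y} -> F x = F y.

Lemma local_sub V (S S' : seq F2) (F : letters -> V) :
  {subset S <= S'} -> local S F -> local S' F.
Proof. by move=> SS' lF x y xy; apply: lF => g /SS'; exact: xy. Qed.

Lemma measurable_at g s : measurable_fun setT (fun x : letters => x g == s).
Proof.
apply: (@measurableT_comp _ _ _ _ _ _ (fun t => t == s)) => //.
exact: measurable_coord.
Qed.

Lemma measurable_translate g : measurable_fun setT (translate g).
Proof. exact: (@measurable_relabel F2 _ _ (fun h => g^-1 * h)%g (fun=> id)). Qed.

Lemma measurable_flip g : measurable_fun setT (flip g).
Proof. exact: (@measurable_relabel F2). Qed.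

Lemma flipE g x : flip g x g = other (x g).
Proof. by rewrite /flip /relabel eqxx. Qed.

Lemma flip_neq g h x : h != g -> flip g x h = x h.
Proof. by rewrite /flip /relabel => /negbTE ->. Qed.

Section CoinFlips.
Context (R : realType).
Local Notation bm := (@bounded_measurable _ letters R).

Lemma bounded_measurable_translate g F : bm F -> bm (fun x => F (translate g x)).
Proof. by apply: bounded_measurable_comp; exact: measurable_translate. Qed.

Lemma bounded_measurable_flip g F : bm F -> bm (fun x => F (flip g x)).
Proof. by apply: bounded_measurable_comp; exact: measurable_flip. Qed.

Lemma bounded_measurable_at g s : bm (fun x => (x g == s)%:R).
Proof. by apply: bounded_measurable_bool; exact: measurable_at. Qed.

Lemma local_at g s : local [:: g] (fun x => (x g == s)%:R : R).
Proof. by move=> x y xy; rewrite xy// mem_head. Qed.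

Variable P : probability letters R.
Hypothesis hP : is_product_measure (@fair_coin R) P.
Local Notation E := (mean P).

Lemma translate_preserving g A : measurable A -> P (translate g @^-1` A) = P A.
Proof.
by apply: (product_measure_relabel (t := fun=> id) hP (mulVKg g)) => // _;
  exact: measurable_id.
Qed.

Lemma fair_coin_other (B : set letter) :
  fair_coin R (other @^-1` B) = fair_coin R B.
Proof.
have memo s : (s \in other @^-1` B) = (other s \in B).
  by apply/idP/idP; rewrite !inE.
by rewrite /fair_coin !diracE !memo /= addeC.
Qed.

Lemma flip_preserving g A : measurable A -> P (flip g @^-1` A) = P A.
Proof.
apply: (product_measure_relabel (r := id) hP) => // h; case: eqP => // _ B _.
exact: fair_coin_other.
Qed.

Lemma mean_translate g F : bm F -> E (fun x => F (translate g x)) = E F.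
Proof.
by apply: mean_comp; [exact: measurable_translate|exact: translate_preserving].
Qed.

Lemma mean_flip g F : bm F -> E (fun x => F (flip g x)) = E F.
Proof. by apply: mean_comp; [exact: measurable_flip|exact: flip_preserving]. Qed.

(** Averaging [F] over the flip at a coordinate makes it independent of that
    coordinate without changing its mean against a function that does not look
    there; doing so along [S] turns [F] into the constant [E F]. *)
Lemma mean_local_mul (S S' : seq F2) F G : bm F -> bm G ->
  local S F -> local S' G -> {in S, forall g, g \notin S'} ->
  E (fun x => F x * G x) = E F * E G.
Proof.
move=> + mG; elim: S F => [|g S IH] F mF lF lG SS'.
  have FE x : F x = F (fun=> La) by exact: lF.
  rewrite (eq_mean _ (G := fun x => F (fun=> La) * G x)); last first.
    by move=> x; rewrite FE.
  by rewrite meanZ// (eq_mean _ FE) mean_cst.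
pose F' x := 2^-1 * (F x + F (flip g x)).
have mF2 : bm (fun x => F (flip g x)) by exact: bounded_measurable_flip.
have mF' : bm F' by apply/bounded_measurableZ/bounded_measurableD.
have lF' : local S F'.
  move=> x y xy; rewrite /F'; congr (_ * _).
  have flip_eq x' y' : {in S, x' =1 y'} -> x' g = y' g -> F x' = F y'.
    by move=> xy' xyg; apply: lF => h; rewrite inE => /orP[/eqP->//|/xy'].
  have in_flip x' y' : {in S, x' =1 y'} -> {in S, flip g x' =1 flip g y'}.
    by move=> xy' h hS; rewrite /flip /relabel xy'.
  have in_flip1 x' y' : {in S, x' =1 y'} -> x' g <> y' g ->
      {in S, x' =1 flip g y'}.
    move=> xy' xyg h hS; have [hg|hg] := eqVneq h g.
      by move: xyg; rewrite -hg xy'.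
    by rewrite flip_neq ?xy'.
  have [xyg|/eqP xyg] := eqVneq (x g) (y g).
    by congr (_ + _); apply: flip_eq => //; [exact: in_flip|rewrite !flipE xyg].
  have xyg' : x g = other (y g).
    by have := letter_eq (x g) (y g); case: eqP => //= _ /eqP.
  rewrite addrC; congr (_ + _); apply: flip_eq => //; rewrite ?flipE//.
  - move=> h hS; apply/esym; apply: in_flip1 => //; last exact: nesym.
    by move=> h' h'S; rewrite xy.
  - by rewrite xyg' otherK.
  - exact: in_flip1.
have EFG : E (fun x => F' x * G x) = E (fun x => F x * G x).
  have -> : (fun x => F' x * G x) =
      (fun x => 2^-1 * (F x * G x + F (flip g x) * G (flip g x))).
    apply/funext => x; rewrite /F' -mulrA mulrDl; congr (_ * (_ + _ * _)).
    apply: lG => h hS'; rewrite flip_neq//.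
    by apply: contraTneq hS' => ->; apply: SS'; rewrite mem_head.
  have mFG : bm (fun x => F x * G x) by exact: bounded_measurableM.
  rewrite meanZ ?meanD//; last 2 first.
  - exact: (bounded_measurable_flip g mFG).
  - by apply: bounded_measurableD => //; exact: (bounded_measurable_flip g mFG).
  have /= -> := mean_flip g mFG.
  lra.
have EF : E F' = E F.
  rewrite meanZ ?meanD//; last exact: bounded_measurableD.
  have /= -> := mean_flip g mF.
  lra.
rewrite -EFG -EF; apply: IH => // h hS; apply: SS'.
by rewrite inE hS orbT.
Qed.

Lemma mean_at g s : E (fun x => (x g == s)%:R) = 2^-1.
Proof.
have ab t : E (fun x => (x g == other t)%:R) = E (fun x => (x g == t)%:R).
  rewrite -(mean_flip g (bounded_measurable_at g (other t))).
  apply: eq_mean => x; rewrite flipE; congr (nat_of_bool _)%:R.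
  by rewrite (inj_eq (inv_inj otherK)).
have : E (fun x => (x g == s)%:R + (x g == other s)%:R) = 1.
  rewrite -[RHS](mean_cst P); apply: eq_mean => x.
  by case: (x g); case: s => /=; rewrite ?addr0 ?add0r.
rewrite meanD; [|exact: bounded_measurable_at..].
rewrite ab; lra.
Qed.

End CoinFlips.

(** * The transfer operator of a step along the open path *)

(** The vertices separated from the origin by one of the two edges that may
    enter it: everything that a forward path can visit before it reaches the
    origin lies here. *)
Definition behind (g : F2) : bool := if word g is (_, false) :: _ then true else false.

Lemma word_geninvM s g : word ((gen s)^-1 * g)%g = cons_red (s, false) (word g).
Proof. by []. Qed.

Lemma behind_geninv s : behind ((gen s)^-1%g).
Proof. by []. Qed.

Lemma word_geninvM_behind s g : behind g ->
  word ((gen s)^-1 * g)%g = (s, false) :: word g.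
Proof.
rewrite word_geninvM /behind; case: (word g) => [//|[t []] w] //= _.
by case: eqP => // -[].
Qed.

Lemma behind_geninvM s g : behind g -> behind ((gen s)^-1 * g)%g.
Proof. by move=> gD; rewrite /behind word_geninvM_behind. Qed.

Lemma behind1 : behind 1%g = false. Proof. by []. Qed.

Definition branch_support (s : letter) (S : seq F2) : seq F2 :=
  [seq ((gen s)^-1 * g)%g | g <- 1%g :: S].

Lemma branch_supportP s S g : all behind S -> g \in branch_support s S ->
  ohead (word g) = Some (s, false).
Proof.
move=> /allP SD /mapP[h + ->]; rewrite inE => /orP[/eqP->|/SD hD].
  by rewrite mulg1.
by rewrite word_geninvM_behind.
Qed.

Lemma branch_support_behind s S : all behind S -> all behind (branch_support s S).
Proof.
move=> SD; apply/allP => g /(branch_supportP SD); rewrite /behind.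
by case: (word g) => //= -[t []] w // [].
Qed.

(** The two supports lie beyond different edges at the origin; this is what makes
    the two branches independent. *)
Lemma branch_support_disjoint S S' : all behind S -> all behind S' ->
  {in branch_support La S, forall g, g \notin branch_support Lb S'}.
Proof.
move=> SD S'D g /(branch_supportP SD) gE; apply/negP.
by move=> /(branch_supportP S'D); rewrite gE.
Qed.

(** Left multiplication by an inverse generator shortens the words that are not
    yet [behind], and keeps [behind] those that are. *)
Lemma branch_support_shrink s S k :
  all (fun g => behind g || (size (word g) < k.+1)%N) S ->
  all (fun g => behind g || (size (word g) < k)%N) (branch_support s S).
Proof.
move=> /allP SD; apply/allP => g /mapP[h + ->]; rewrite inE => /orP[/eqP->|hS].
  by rewrite mulg1 behind_geninv.
have [hD|nhD] := boolP (behind h); first by rewrite behind_geninvM.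
have := SD _ hS; rewrite (negbTE nhD) /=.
move: nhD; rewrite /behind word_geninvM.
case: (word h) => [//|[t []] w] //= _.
by rewrite ltnS => wk; case: eqP => //= _; rewrite wk orbT.
Qed.

Section Transfer.
Context (R : realType).
Local Notation bm := (@bounded_measurable _ letters R).
Implicit Types (F G Y h : letters -> R).

Definition branch s F (x : letters) : R :=
  (x ((gen s)^-1%g) == s)%:R * F (translate (gen s) x).

(** The sum runs over the possible predecessors [(gen s)^-1] of the origin. This
    is the adjoint in L2 of the step [x |-> translate (gen (x 1))^-1 x], which
    moves the origin along its outgoing open edge. *)
Definition transfer F (x : letters) : R := \sum_s branch s F x.

Lemma big_letter (f : letter -> R) : \sum_s f s = f La + f Lb.
Proof.
rewrite (bigD1 La) //= (bigD1 Lb) //= big1 ?addr0 // => s.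
by case: s.
Qed.

Lemma branchE s F x :
  branch s F x = (translate (gen s) x 1%g == s)%:R * F (translate (gen s) x).
Proof. by rewrite translateE mulg1. Qed.

Lemma bounded_measurable_branch s F : bm F -> bm (branch s F).
Proof.
move=> mF; apply: bounded_measurableM; first exact: bounded_measurable_at.
exact: bounded_measurable_translate.
Qed.

Lemma bounded_measurable_transfer F : bm F -> bm (transfer F).
Proof.
by move=> mF; apply: bounded_measurable_sum => s; exact: bounded_measurable_branch.
Qed.

Lemma local_branch s S F : local S F -> local (branch_support s S) (branch s F).
Proof.
move=> lF x y xy; rewrite /branch xy; last first.
  by rewrite -[X in X \in _]mulg1; apply: map_f; rewrite mem_head.
congr (_ * _); apply: lF => g gS; rewrite !translateE xy//.
by apply: map_f; rewrite inE gS orbT.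
Qed.

Lemma local_transfer S F : local S F ->
  local (branch_support La S ++ branch_support Lb S) (transfer F).
Proof.
move=> lF x y xy; apply: eq_bigr => s _; apply: (local_branch lF) => g gS.
by apply: xy; rewrite mem_cat; case: s gS => ->; rewrite ?orbT.
Qed.

Variable P : probability letters R.
Hypothesis hP : is_product_measure (@fair_coin R) P.
Local Notation E := (mean P).

Lemma mean_branch s S F : bm F -> local S F -> all behind S ->
  E (branch s F) = 2^-1 * E F.
Proof.
move=> mF lF /allP SD.
rewrite (eq_mean _ (branchE s F)).
rewrite (@mean_translate _ _ hP (gen s) (fun x => (x 1%g == s)%:R * F x)); last first.
  by apply: bounded_measurableM => //; exact: bounded_measurable_at.
rewrite (mean_local_mul hP _ mF (@local_at R 1%g s) lF).
- by rewrite mean_at.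
- exact: bounded_measurable_at.
- move=> g; rewrite inE => /eqP ->; apply/negP => /SD.
  by rewrite behind1.
Qed.

Lemma mean_branchM S F S' G : bm F -> local S F -> all behind S ->
  bm G -> local S' G -> all behind S' ->
  E (fun x => branch La F x * branch Lb G x) = 2^-1 * E F * (2^-1 * E G).
Proof.
move=> mF lF SD mG lG SD'.
rewrite (mean_local_mul hP _ _ (local_branch lF) (local_branch lG)).
- by rewrite (mean_branch _ mF lF)// (mean_branch _ mG lG).
- exact: bounded_measurable_branch.
- exact: bounded_measurable_branch.
- exact: branch_support_disjoint.
Qed.

(** Split according to the letter [s] read at the origin, use the invariance to
    evaluate [f] at the configuration seen from [gen s], and recentre there by
    translation invariance of [P]. *)
Lemma mean_mul_transfer (f h : letters -> R) : bm f -> bm h ->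
  (forall x, f (translate ((gen (x 1%g))^-1%g) x) = f x) ->
  E (fun x => f x * h x) = E (fun x => f x * transfer h x).
Proof.
move=> mf mh finv.
have mat s : bm (fun x => (x 1%g == s)%:R * (f (translate ((gen s)^-1%g) x) * h x)).
  apply: bounded_measurableM; first exact: bounded_measurable_at.
  by apply: bounded_measurableM => //; exact: bounded_measurable_translate.
transitivity (E (fun x => \sum_s (x 1%g == s)%:R * (f (translate ((gen s)^-1%g) x) * h x))).
  apply: eq_mean => x; rewrite (bigD1 (x 1%g)) //= eqxx mul1r finv.
  by rewrite big1 ?addr0// => s /negbTE; rewrite eq_sym => ->; rewrite mul0r.
have -> : (fun x => f x * transfer h x) = (fun x => \sum_s f x * branch s h x).
  by apply/funext => x; rewrite /transfer big_distrr.
rewrite !mean_sum//; last first.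
  by move=> s; apply: bounded_measurableM => //; exact: bounded_measurable_branch.
apply: eq_bigr => s _; rewrite -(mean_translate hP (gen s) (mat s)).
apply: eq_mean => x; rewrite -translateM mulVg translate1 branchE.
by rewrite mulrCA.
Qed.

Lemma mean_transfer F : bm F -> E (transfer F) = E F.
Proof.
move=> mF; have := @mean_mul_transfer (fun=> 1) F (bounded_measurable_cst _ 1) mF.
have mul1 G : (fun x => 1 * G x) = G by apply/funext => x; rewrite mul1r.
by rewrite !mul1 => ->.
Qed.

(** The cross term of the square vanishes: the two branches are independent and
    each has mean zero. *)
Lemma mean_transfer_sqr S F : bm F -> local S F -> all behind S -> E F = 0 ->
  E (fun x => transfer F x ^+ 2) = E (fun x => F x ^+ 2).
Proof.
move=> mF lF SD F0.
have mF2 : bm (fun x => F x ^+ 2) by exact: bounded_measurableM.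
have lF2 : local S (fun x => F x ^+ 2) by move=> x y xy; rewrite (lF x y).
have mb s G : bm G -> bm (branch s G) by exact: bounded_measurable_branch.
transitivity (E (fun x => (branch La (fun x => F x ^+ 2) x +
     branch Lb (fun x => F x ^+ 2) x) + 2 * (branch La F x * branch Lb F x))).
  apply: eq_mean => x; rewrite /transfer big_letter /branch.
  by case: (_ == La); case: (_ == Lb) => /=; ring.
have mab : bm (fun x => branch La F x * branch Lb F x).
  by apply: bounded_measurableM; exact: mb.
rewrite meanD ?meanZ//.
- rewrite meanD; [|exact: mb..].
  rewrite (mean_branch _ mF2 lF2)// (mean_branch _ mF2 lF2)//.
  rewrite (mean_branchM mF lF _ mF lF)// F0; lra.
- by apply: bounded_measurableD; exact: mb.
- exact: bounded_measurableZ.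
Qed.

(** * Extinction of the ancestors and mixing *)

(** Whether some forward path reaches the origin in exactly [m] steps. The
    generations of such ancestors form a Galton-Watson process with offspring
    law Binomial(2, 1/2), of mean 1, so they die out. *)
Fixpoint alive (m : nat) (x : letters) : bool :=
  if m is m'.+1 then
    (x ((gen La)^-1%g) == La) && alive m' (translate (gen La) x) ||
    (x ((gen Lb)^-1%g) == Lb) && alive m' (translate (gen Lb) x)
  else true.

Definition aliveR m x : R := (alive m x)%:R.

Lemma aliveRS m x : aliveR m.+1 x =
  branch La (aliveR m) x + branch Lb (aliveR m) x -
  branch La (aliveR m) x * branch Lb (aliveR m) x.
Proof.
rewrite /branch /aliveR /=.
by case: (_ == La); case: (_ == Lb); case: alive; case: alive => /=; ring.
Qed.

Lemma aliveR_local m : bm (aliveR m) /\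
  exists2 S, all behind S & local S (aliveR m).
Proof.
elim: m => [|m [mm [S SD lS]]].
  split; first exact: bounded_measurable_cst.
  by exists [::].
have mb s := bounded_measurable_branch s mm.
have -> : aliveR m.+1 = fun x => branch La (aliveR m) x + branch Lb (aliveR m) x -
  branch La (aliveR m) x * branch Lb (aliveR m) x.
  by apply/funext => x; rewrite aliveRS.
split.
  apply: bounded_measurableB; first exact: bounded_measurableD.
  exact: bounded_measurableM.
exists (branch_support La S ++ branch_support Lb S).
  by rewrite all_cat !branch_support_behind.
have bl s : local (branch_support La S ++ branch_support Lb S) (branch s (aliveR m)).
  apply: local_sub (local_branch lS) => g gS; rewrite mem_cat.
  by case: s gS => ->; rewrite ?orbT.
by move=> x y xy; rewrite !(bl _ x y).
Qed.

Lemma mean_aliveS m :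
  E (aliveR m.+1) = E (aliveR m) - E (aliveR m) ^+ 2 / 4.
Proof.
have [mm [S SD lS]] := aliveR_local m.
have mb s := bounded_measurable_branch s mm.
rewrite (eq_mean _ (aliveRS m)) meanB.
- rewrite meanD// !(mean_branch _ mm lS)// (mean_branchM mm lS _ mm lS)//; lra.
- exact: bounded_measurableD.
- exact: bounded_measurableM.
Qed.

(** The recursion [q |-> q - q^2 / 4] of the survival probabilities maps
    [[0, 4 / (m + 4)]] into [[0, 4 / (m + 5)]]. *)
Lemma mean_alive_le m : E (aliveR m) <= 4 / (m%:R + 4).
Proof.
have : 0 <= E (aliveR m) <= 4 / (m%:R + 4); last by case/andP.
elim: m => [|m].
  by rewrite mean_cst mulr0n add0r divff ?ler01 ?lexx.
rewrite mean_aliveS -[m.+1%:R]natr1; set q := E _ => /andP[q0 qm].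
have m0 : 0 <= m%:R :> R by [].
move: (m%:R : R) m0 qm => t t0 qm.
have t4 : 0 < t + 4 by lra.
have {}qm : q * (t + 4) <= 4 by rewrite -ler_pdivlMr.
have q1 : q <= 1 by nra.
apply/andP; split; first by nra.
rewrite ler_pdivlMr; last lra.
nra.
Qed.

Lemma transfer_support m F x : iter m transfer F x != 0 -> alive m x.
Proof.
elim: m x => [//|m IH] x /=; apply: contraNT; rewrite negb_or !negb_and.
rewrite {1}/transfer big_letter /branch => /andP[nA nB].
have vanish s : (x ((gen s)^-1%g) != s) || ~~ alive m (translate (gen s) x) ->
    (x ((gen s)^-1%g) == s)%:R * iter m transfer F (translate (gen s) x) = 0.
  move=> /orP[/negbTE->|na]; first by rewrite mul0r.
  by rewrite (contraNeq (IH _) na) mulr0.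
by rewrite !vanish// addr0.
Qed.

(** Each application of [transfer] shortens by one the words of the support that
    are not yet behind the origin. *)
Lemma transfer_behind F S : bm F -> local S F -> E F = 0 ->
  exists k S', [/\ bm (iter k transfer F), local S' (iter k transfer F),
    E (iter k transfer F) = 0 & all behind S'].
Proof.
move=> mF lF F0.
have [k Sk] : exists k, all (fun g => behind g || (size (word g) < k)%N) S.
  exists (\max_(g <- S) size (word g)).+1; apply/allP => g gS.
  by rewrite ltnS (leq_bigmax_seq (F := fun g : F2 => size (word g)))// orbT.
elim: k F S mF lF F0 Sk => [|k IH] F S mF lF F0 Sk.
  by exists 0%N, S; split=> //; apply: sub_all Sk => g; rewrite orbF.
have mT := bounded_measurable_transfer mF.
have [||k' [S' [? ? ? ?]]] := IH _ _ mT (local_transfer lF).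
- by rewrite mean_transfer.
- by rewrite all_cat !branch_support_shrink.
by exists k'.+1, S'; rewrite iterSr.
Qed.

Lemma transfer_iter m F S : bm F -> local S F -> E F = 0 -> all behind S ->
  bm (iter m transfer F) /\
  E (fun x => iter m transfer F x ^+ 2) = E (fun x => F x ^+ 2).
Proof.
elim: m F S => [//|m IH] F S mF lF F0 SD; rewrite iterSr.
have mT := bounded_measurable_transfer mF.
have [||mm mE] := IH _ _ mT (local_transfer lF).
- by rewrite mean_transfer.
- by rewrite all_cat !branch_support_behind.
by split=> //; rewrite mE (mean_transfer_sqr mF lF).
Qed.

Lemma mean_mul_transfer_iter (f h : letters -> R) k : bm f -> bm h ->
  (forall x, f (translate ((gen (x 1%g))^-1%g) x) = f x) ->
  E (fun x => f x * h x) = E (fun x => f x * iter k transfer h x).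
Proof.
move=> mf mh finv; elim: k h mh => [//|k IH] h mh.
rewrite (mean_mul_transfer mf mh finv) iterSr; apply: IH.
exact: bounded_measurable_transfer.
Qed.

(** The iterates [Z] of a mean-zero local function under [transfer] keep their
    second moment, but vanish unless the origin is [alive m], an event of
    vanishing probability. Hence [Z] tends to 0 in L1, and so does its integral
    against the bounded [f], which does not depend on [m]. *)
Lemma mean_mul_local_eq0 (f h : letters -> R) S : bm f -> (forall x, `|f x| <= 1) ->
  (forall x, f (translate ((gen (x 1%g))^-1%g) x) = f x) ->
  bm h -> local S h -> E h = 0 -> E (fun x => f x * h x) = 0.
Proof.
move=> mf f1 finv mh lh h0.
have [k [S' [mY lY Y0 SD]]] := transfer_behind mh lh h0.
rewrite (mean_mul_transfer_iter k mf mh finv).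
move: (iter k transfer h) mY lY Y0 => Y mY lY Y0.
set c := E _; set v := E (fun x => Y x ^+ 2).
(* From [|f Z| <= |Z| <= (l * aliveR m + Z ^ 2 / l) / 2]. *)
have bound m (l : R) : 0 < l -> `|c| <= 2^-1 * (l * E (aliveR m) + l^-1 * v).
  move=> l0.
  have [mm mv] := transfer_iter m mY lY Y0 SD.
  rewrite /c (mean_mul_transfer_iter m mf mY finv) /v -mv.
  have [ma _] := aliveR_local m.
  move: (transfer_support (m := m) (F := Y)) mm.
  move: (iter m transfer Y) => Z Zalive mZ.
  have mla : bm (fun x => l * aliveR m x) by exact: bounded_measurableZ.
  have mZ2 : bm (fun x => l^-1 * Z x ^+ 2).
    by apply: bounded_measurableZ; exact: bounded_measurableM.
  have mB := bounded_measurableZ 2^-1 (bounded_measurableD mla mZ2).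
  have -> : 2^-1 * (l * E (aliveR m) + l^-1 * E (fun x => Z x ^+ 2)) =
      E (fun x => 2^-1 * (l * aliveR m x + l^-1 * Z x ^+ 2)).
    rewrite meanZ ?meanD ?meanZ//; first exact: bounded_measurableM.
    exact: bounded_measurableD.
  have pt x : `|f x * Z x| <= 2^-1 * (l * aliveR m x + l^-1 * Z x ^+ 2).
    rewrite normrM; apply: (@le_trans _ _ `|Z x|).
      by rewrite -[leRHS]mul1r ler_wpM2r.
    rewrite /aliveR; have [Z0|/Zalive ->] := eqVneq (Z x) 0.
      by rewrite Z0 normr0 expr0n mulr0 addr0 mulr_ge0 // mulr_ge0// ltW.
    rewrite -[Z x ^+ 2]real_normK ?num_real//= mulr1.
    have z0 := normr_ge0 (Z x); move: `|Z x| z0 => z z0.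
    have -> : 2^-1 * (l + l^-1 * z ^+ 2) = z + 2^-1 * l^-1 * (l - z) ^+ 2.
      by field; rewrite gt_eqF.
    rewrite lerDl mulr_ge0 ?sqr_ge0// mulr_ge0// ?invr_ge0// ltW//.
  have mfZ : bm (fun x => f x * Z x) by exact: bounded_measurableM.
  rewrite ler_norml; apply/andP; split.
    rewrite -mulN1r -meanZ//; apply: le_mean => //.
      exact: bounded_measurableZ.
    by move=> x; rewrite mulN1r; have := pt x; rewrite ler_norml => /andP[].
  by apply: le_mean => // x; have := pt x; rewrite ler_norml => /andP[].
apply/eqP; apply/negPn/negP => c0.
have {}c0 : 0 < `|c| by rewrite normr_gt0.
have v0 : 0 <= v.
  rewrite -[leLHS](mean_cst P); apply: le_mean => //.
  - exact: bounded_measurable_cst.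
  - exact: bounded_measurableM.
  - by move=> x; exact: sqr_ge0.
move: `|c| c0 bound => C C0 bound.
(* This [l] makes [v / l <= C], so that [bound] leaves [C <= l * E (aliveR m)]. *)
pose l := (v + 1) / C.
have l0 : 0 < l by rewrite divr_gt0//; lra.
have lv : l^-1 * v <= C.
  by rewrite /l invf_div mulrAC ler_pdivrMr; nra.
have Cq m : C <= l * E (aliveR m) by have := bound m l l0; lra.
have Cm m : C * (m%:R + 4) <= l * 4.
  have := Cq m; have := mean_alive_le m.
  have m0 : 0 <= m%:R :> R by [].
  rewrite ler_pdivlMr; nra.
have [m ml] : exists m : nat, l * 4 / C < m%:R.
  exists (Num.bound (l * 4 / C)); apply: archi_boundP.
  by apply: divr_ge0; [apply: mulr_ge0 => //|]; exact: ltW.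
have := Cm m; rewrite ltr_pdivrMr// in ml; nra.
Qed.

End Transfer.

(** * Countability of the free group *)

Definition vertex_index (g : F2) : nat := pickle (word g).

Definition vertex_at (n : nat) : F2 :=
  if unpickle n is Some w then insubd (1%g : F2) w else 1%g.

Lemma vertex_indexK : cancel vertex_index vertex_at.
Proof. by move=> g; rewrite /vertex_at /vertex_index pickleK /= valKd. Qed.

Lemma bigcap_vertex T (A : F2 -> set T) :
  \bigcap_v A v = \bigcap_n A (vertex_at n).
Proof.
apply/seteqP; split=> x Ax i _; first exact: Ax.
by rewrite -(vertex_indexK i); exact: Ax.
Qed.

Lemma bigcup_vertex T (A : F2 -> set T) :
  \bigcup_v A v = \bigcup_n A (vertex_at n).
Proof.
apply/seteqP; split=> x [i _ Ax]; last by exists (vertex_at i).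
by exists (vertex_index i); rewrite // vertex_indexK.
Qed.

Section Sections.
Context (d : measure_display) (X : measurableType d).

Lemma measurable_fun_section d' (Z : measurableType d') (f : X * F2 -> Z) v :
  measurable_fun setT f -> measurable_fun setT (fun x => f (x, v)).
Proof.
by move=> mf; apply: (measurableT_comp mf); exact: pair2_measurable.
Qed.

Lemma measurable_fun_sections d' (Z : measurableType d') (f : X * F2 -> Z) :
  (forall v, measurable_fun setT (fun x => f (x, v))) -> measurable_fun setT f.
Proof.
move=> mf _ B mB; rewrite setTI.
have -> : f @^-1` B =
    \bigcup_v (((fun x => f (x, v)) @^-1` B) `*` [set v]).
  apply/seteqP; split=> [[x v] fB|[x v] [w _ [/= fB ->]] //].
  by exists v.
rewrite bigcup_vertex; apply: bigcup_measurable => n _; apply: measurableX => //.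
by rewrite -[X in measurable X]setTI; exact: mf.
Qed.

Lemma measurable_bool_set (b : X -> bool) :
  measurable_fun setT b -> measurable [set x | b x].
Proof.
move=> mb; have -> : [set x | b x] = setT `&` b @^-1` [set true] by rewrite setTI.
exact: mb.
Qed.

Lemma measurable_set_bool (A : set X) :
  measurable A -> measurable_fun setT (fun x => `[< A x >]).
Proof.
move=> mA; apply: (@measurable_fun_bool _ _ _ _ true); rewrite setTI.
by rewrite (_ : _ @^-1` _ = A)//; apply/seteqP; split=> x /asboolP.
Qed.

Lemma probability_bigcap_vertex (R : realType) (P : probability X R)
    (A : F2 -> set X) : (forall v, measurable (A v)) ->
  (forall v, P (A v) = 1%E) -> P (\bigcap_v A v) = 1%E.
Proof.
move=> mA PA; have mI : measurable (\bigcap_v A v).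
  by rewrite bigcap_vertex; exact: bigcap_measurableType.
have := probability_setC P (measurableC mI); rewrite setCK => ->.
suff -> : P (~` \bigcap_v A v) = 0%E by rewrite sube0.
apply/negligibleP; first exact: measurableC.
rewrite setC_bigcap bigcup_vertex; apply: negligible_bigcup => n.
apply/negligibleP; first exact: measurableC.
by have := probability_setC P (mA (vertex_at n)); rewrite PA subee.
Qed.

End Sections.

(** * Ergodicity of the step *)

Section Ergodicity.
Context (R : realType) (P : probability letters R).
Hypothesis hP : is_product_measure (@fair_coin R) P.
Local Notation E := (mean P).

Variable b : letters -> bool.
Hypothesis mb : measurable_fun setT b.
Hypothesis b_inv : forall x, b (translate (gen (x 1%g))^-1%g x) = b x.

(** The centred indicator of a box is a mean-zero local function, hence
    orthogonal to every invariant function. *)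
Lemma invariant_independent_box F (B : F2 -> set letter) :
  P ([set x | b x] `&` box F B) = (P [set x | b x] * P (box F B))%E.
Proof.
pose c x := `[< box F B x >].
have mc : measurable_fun setT c.
  by apply: measurable_set_bool; exact: measurable_box.
have boxE : box F B = [set x | c x] by apply/seteqP; split=> x /asboolP.
have bc : [set x | b x] `&` box F B = [set x | b x && c x].
  by rewrite boxE; apply/seteqP; split=> x /andP.
have mbc : measurable_fun setT (fun x => b x && c x).
  by apply: measurable_and.
rewrite bc boxE !mean_bool// -EFinM; congr (_%:E).
have bb := bounded_measurable_bool R mb.
have bbc := bounded_measurable_bool R mc.
pose h x : R := (c x)%:R - E (fun x => (c x)%:R).
have mh : bounded_measurable h.
  by apply: bounded_measurableB => //; exact: bounded_measurable_cst.
have : E (fun x => (b x)%:R * h x) = 0.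
  apply: (@mean_mul_local_eq0 _ _ hP _ _ F) => //.
  - by move=> x; case: (b x); rewrite ?normr1 ?normr0.
  - by move=> x; rewrite b_inv.
  - move=> x y xy; rewrite /h /c; congr ((nat_of_bool _)%:R - _).
    by apply: asbool_equiv_eq; split=> h' g gF; have := h' g gF; rewrite xy.
  - rewrite /h meanB ?mean_cst ?subrr//; exact: bounded_measurable_cst.
have -> : (fun x => (b x)%:R * h x) =
   (fun x => (b x && c x)%:R - E (fun x => (c x)%:R) * (b x)%:R).
  by apply/funext => x; rewrite /h mulrBr -natrM mulnb [in RHS]mulrC.
rewrite meanB; [|exact: bounded_measurable_bool|exact: bounded_measurableZ].
by rewrite meanZ// mulrC => /eqP; rewrite subr_eq0 => /eqP.
Qed.

(** An event independent of all boxes is independent of every event, in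
    particular of itself. *)
Lemma invariant_zero_one : P [set x | b x] = 0%E \/ P [set x | b x] = 1%E.
Proof.
have mA := measurable_bool_set mb.
set A := [set x | b x] in mA *.
have PAfin : P A \is a fin_num by rewrite fin_num_measure.
pose p : {nonneg R} := NngNum (fine_ge0 (measure_ge0 P A)).
have pE : p%:num%:E = P A by rewrite /= fineK.
have : mrestr P mA A = mscale p P A.
  apply: (@eq_measure_box F2 _ letter R (mrestr P mA) (mscale p P)) => //.
  - move=> F B _ _; rewrite /= /mrestr /mscale /= pE setIC.
    exact: invariant_independent_box.
  - rewrite /= /mrestr setTI; apply: le_lt_trans (ltry 1).
    exact: probability_le1.
rewrite /mrestr /mscale setIid pE => PAA.
have [t PAt] : exists t : R, P A = t%:E by exists (fine (P A)); rewrite fineK.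
have : t%:E = (t%:E * t%:E)%E by rewrite -PAt.
rewrite -EFinM PAt => -[] /eqP; rewrite -subr_eq0 -{1}[t]mulr1 -mulrBr mulf_eq0.
by move=> /orP[/eqP->|]; [left|rewrite subr_eq0 => /eqP <-; right].
Qed.

End Ergodicity.

(** * Open paths *)

(** The other endpoint of the only open edge [{v, v * gen s}] leaving [v]. *)
Definition forward (x : letters) (v : F2) : F2 := (v * gen (x v))%g.

Lemma forward_translate g x v : forward (translate g x) (g * v)%g = (g * forward x v)%g.
Proof. by rewrite /forward translateE mulKg mulgA. Qed.

Lemma open_neighborP x u v :
  reflect (v = forward x u \/ u = forward x v) (open_neighbor (coin_map x) u v).
Proof.
rewrite /coin_map; apply: (iffP existsP) => /= [[s]|].
  by move=> /orP[/andP[/eqP-> /eqP<-]|/andP[/eqP-> /eqP<-]]; [left|right].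
by case=> ->; [exists (x u)|exists (x v)]; rewrite !eqxx ?orbT.
Qed.

Lemma same_cluster_refl w v : same_cluster w v v.
Proof. by exists [::]. Qed.

Lemma same_cluster_forward x u v :
  same_cluster (coin_map x) u v -> same_cluster (coin_map x) u (forward x v).
Proof.
move=> [p pp <-]; exists (rcons p (forward x (last u p))); last by rewrite last_rcons.
by rewrite rcons_path pp; apply/open_neighborP; left.
Qed.

Lemma same_cluster_iter x v n : same_cluster (coin_map x) v (iter n (forward x) v).
Proof.
elim: n => [|n IH]; [exact: same_cluster_refl|exact: same_cluster_forward].
Qed.

(** Every vertex has exactly one outgoing open edge, so the outgoing paths of
    vertices of the same cluster merge. *)
Lemma same_cluster_meet x u v : same_cluster (coin_map x) u v ->
  exists i j, iter i (forward x) u = iter j (forward x) v.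
Proof.
move=> [p + <-]; elim: p u => [|w p IH] u /=; first by exists 0%N, 0%N.
move=> /andP[/open_neighborP uw /IH [i [j ij]]].
case: uw ij => [-> ij|->]; first by exists i.+1, j; rewrite iterSr.
case: i => [|i] ij; last by exists i, j; rewrite -ij iterSr.
by exists 0%N, j.+1; rewrite /= -ij.
Qed.

(** The exponent sum. It grows by one along each open edge traversed forward, so
    forward paths never come back. *)
Definition level (g : F2) : int := \sum_(l <- word g) (if l.2 then 1 else -1).

Lemma level_gen g s : level (g * gen s)%g = level g + 1.
Proof.
have level_cons (l : letter * bool) w :
    \sum_(m <- cons_red l w) (if m.2 then 1 else -1) =
    (if l.2 then 1 else -1) + \sum_(m <- w) (if m.2 then 1 else -1) :> int.
  case: w => [|m w] /=; first by rewrite big_cons.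
  case: eqP => [->|_]; rewrite ?big_cons//=.
  by case: (l.2); rewrite addrA ?subrr ?addNr add0r.
rewrite /level; have -> : word (g * gen s)%g = mul_word g [:: (s, true)] by [].
elim: (word g) => [|l w IH]; first by rewrite /= !big_cons big_nil addrC.
by rewrite /= level_cons IH big_cons addrA.
Qed.

Lemma level_iter x v n : level (iter n (forward x) v) = level v + n%:R.
Proof.
elim: n => [|n IH]; first by rewrite addr0.
by rewrite iterS level_gen IH -addrA natr1.
Qed.

Lemma all_infinite x : infinite_vertices (coin_map x) = setT.
Proof.
apply/seteqP; split=> // v _ fin; apply: infinite_nat.
pose f n := iter n (forward x) v.
have -> : [set: nat] = f @^-1` cluster_of (coin_map x) v.
  by apply/seteqP; split=> // n _; exact: same_cluster_iter.
apply: finite_preimage fin => m n _ _ /(congr1 level).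
by rewrite !level_iter => /addrI /eqP; rewrite eqr_nat => /eqP.
Qed.

(** * Indistinguishability *)

(** All vertices lie in infinite clusters, so constancy must hold on the whole
    group. The value at the origin of a cluster property is invariant under the
    step along the outgoing edge, hence almost surely constant by ergodicity,
    and equivariance carries this over to every vertex. *)
Lemma coin_indistinguishability (R : realType) (P : probability letters R) :
  is_product_measure (@fair_coin R) P ->
  indistinguishability (@config_shift _ letter) P coin_map.
Proof.
move=> hP Q [[mQ Qact] Qcl].
have mQv v : measurable_fun setT (fun x => Q (x, v)) by exact: measurable_fun_section.
have QE x v : Q (x, v) = Q (translate v^-1%g x, 1%g).
  by rewrite -(Qact v^-1%g x v) mulVg.
have PQ v : P [set x | Q (x, v)] = P [set x | Q (x, 1%g)].
  rewrite -(translate_preserving hP v^-1%g (measurable_bool_set (mQv 1%g))).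
  by congr (P _); apply/funext => x; congr (is_true _); exact: QE.
have Q_inv x : Q (translate (gen (x 1%g))^-1%g x, 1%g) = Q (x, 1%g).
  rewrite -QE; apply/esym/Qcl.
  by have := same_cluster_forward (same_cluster_refl (coin_map x) 1%g); rewrite /forward mul1g.
pose AT := \bigcap_v [set x | Q (x, v)].
pose AF := \bigcap_v ~` [set x | Q (x, v)].
have mAv v := measurable_bool_set (mQv v).
have mAT : measurable AT.
  by rewrite /AT bigcap_vertex; exact: bigcap_measurableType.
have mAF : measurable AF.
  rewrite /AF bigcap_vertex; apply: bigcap_measurableType => n _.
  exact: measurableC.
have -> : [set x | constant_on Q x (infinite_vertices (coin_map x))] = AT `|` AF.
  apply/seteqP; split=> x; rewrite /constant_on /= all_infinite.
    by case=> h; [left|right] => v _ /=; [exact: h|exact/negP/h].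
  by case=> h; [left|right] => v _; [exact: h|exact/negP/(h v)].
have sup (B : set letters) : measurable B -> B `<=` AT `|` AF -> P B = 1%E ->
    P (AT `|` AF) = 1%E.
  move=> mB BA PB; apply/eqP; rewrite eq_le; apply/andP; split.
    by apply: probability_le1; exact: measurableU.
  by rewrite -PB; apply: le_measure; rewrite ?inE//; exact: measurableU.
have [P0|P1] := invariant_zero_one hP (mQv 1%g) Q_inv.
- apply: (sup AF) => //.
  apply: probability_bigcap_vertex => v; first exact: measurableC.
  by have := probability_setC P (mAv v); rewrite PQ P0 sube0.
- apply: (sup AT) => //.
  by apply: probability_bigcap_vertex => // v; rewrite PQ.
Qed.

(** * The letters read along an open path *)

(** The possible vertices among the first [n] of the forward path of the origin,
    as forward paths only use the generators themselves. *)
Fixpoint positive_words (n : nat) : seq F2 :=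
  if n is n'.+1 then
    1%g :: [seq (gen La * g)%g | g <- positive_words n'] ++
           [seq (gen Lb * g)%g | g <- positive_words n']
  else [::].

Lemma word_genM s g : ~~ behind g -> word (gen s * g)%g = (s, true) :: word g.
Proof.
have -> : word (gen s * g)%g = cons_red (s, true) (word g) by [].
by rewrite /behind; case: (word g) => [|[t []] w] //= _; case: eqP.
Qed.

Lemma positive_words_behind n g : g \in positive_words n -> ~~ behind g.
Proof.
elim: n g => [//|n IH] g; rewrite inE mem_cat => /or3P[/eqP->|/mapP|/mapP].
- by rewrite behind1.
- by move=> [h /IH hn ->]; rewrite /behind word_genM.
- by move=> [h /IH hn ->]; rewrite /behind word_genM.
Qed.

Fixpoint count_a (n : nat) (x : letters) (v : F2) : nat :=
  if n is n'.+1 then ((x v == La) + count_a n' x (forward x v))%N else 0%N.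

Lemma count_aD m n x v :
  count_a (m + n) x v = (count_a m x v + count_a n x (iter m (forward x) v))%N.
Proof. by elim: m v => [//|m IH] v; rewrite addSn /= IH addnA -iterSr. Qed.

Lemma count_a_le n x v : (count_a n x v <= n)%N.
Proof.
by elim: n v => [//|n IH] v /=; have := IH (forward x v); case: (_ == La) => /=; lia.
Qed.

Lemma count_a_translate n g x v :
  count_a n (translate g x) (g * v)%g = count_a n x v.
Proof.
elim: n v => [//|n IH] v /=.
by rewrite forward_translate IH translateE mulKg.
Qed.

Lemma measurable_count_a n v : measurable_fun setT (fun x => count_a n x v).
Proof.
elim: n v => [|n IH] v; first exact: measurable_cst.
have -> : (fun x => count_a n.+1 x v) = (fun x => if x v == La
    then (count_a n x (v * gen La)%g).+1 else count_a n x (v * gen Lb)%g).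
  by apply/funext => x /=; rewrite /forward; case: (x v).
apply: measurable_fun_ifT => //; first exact: measurable_at.
exact: (measurableT_comp (f := S)).
Qed.

Lemma local_count_a n v :
  local [seq (v * g)%g | g <- positive_words n] (fun x => count_a n x v).
Proof.
elim: n v => [//|n IH] v x y xy /=.
have xyv : x v = y v.
  by apply: xy; rewrite -[X in X \in _]mulg1; apply: map_f; rewrite mem_head.
rewrite /forward xyv; congr addn; apply: IH => _ /mapP[g gn ->].
rewrite -mulgA; apply: xy; apply: map_f; rewrite inE mem_cat.
by case: (y v); rewrite map_f ?orbT.
Qed.

Section CountLaw.
Context (R : realType).
Local Notation bm := (@bounded_measurable _ letters R).

Lemma bounded_measurable_count_a (f : nat -> R) n v :
  bm (fun x => f (count_a n x v)).
Proof.
split.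
  by apply: (measurableT_comp (f := f)) => //; exact: measurable_count_a.
exists (\sum_(k < n.+1) `|f k|) => x.
have cn : (count_a n x v < n.+1)%N by rewrite ltnS count_a_le.
rewrite (bigD1 (Ordinal cn))//= lerDl; exact: sumr_ge0.
Qed.

Variable P : probability letters R.
Hypothesis hP : is_product_measure (@fair_coin R) P.
Local Notation E := (mean P).

Definition count_mean n (f : nat -> R) := E (fun x => f (count_a n x 1%g)).

Lemma mean_count_a n f v : E (fun x => f (count_a n x v)) = count_mean n f.
Proof.
rewrite /count_mean -(mean_translate hP v (bounded_measurable_count_a f n v)).
apply: eq_mean => x; congr f.
by rewrite -{2}[v]mulg1 count_a_translate.
Qed.

(** The first letter of the path is independent of the rest of it. *)
Lemma count_meanS n f :
  count_mean n.+1 f = 2^-1 * count_mean n (fun k => f k.+1) + 2^-1 * count_mean n f.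
Proof.
have half s (f' : nat -> R) :
    E (fun x => (x 1%g == s)%:R * f' (count_a n x (gen s))) = 2^-1 * count_mean n f'.
  rewrite (mean_local_mul hP (S := [:: 1%g])
    (S' := [seq (gen s * g)%g | g <- positive_words n])).
  - by rewrite mean_at// mean_count_a.
  - exact: bounded_measurable_at.
  - exact: bounded_measurable_count_a.
  - exact: local_at.
  - by move=> x y xy; congr f'; exact: local_count_a xy.
  - move=> g; rewrite inE => /eqP->; apply/mapP => -[h /positive_words_behind hn].
    by move=> /(congr1 (@word _)); rewrite word_genM.
rewrite -(half La) -(half Lb) -meanD; last 2 first.
- apply: bounded_measurableM; first exact: bounded_measurable_at.
  exact: (@bounded_measurable_count_a (fun k => f k.+1)).
- apply: bounded_measurableM; first exact: bounded_measurable_at.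
  exact: bounded_measurable_count_a.
apply: eq_mean => x /=; rewrite /forward mul1g.
by case: (x 1%g) => /=; rewrite mul1r mul0r ?addr0 ?add0r.
Qed.

Lemma count_mean_binomial n k :
  count_mean n (fun c => (k == c)%:R) = 'C(n, k)%:R / 2 ^+ n.
Proof.
elim: n k => [|n IH] k.
  by rewrite /count_mean /= mean_cst bin0n expr0 divr1.
rewrite count_meanS IH; case: k => [|k].
  rewrite {1}/count_mean /= mean_cst !bin0 exprS invfM; lra.
by rewrite /= IH binS natrD exprS invfM; lra.
Qed.

Lemma eq_count_mean n f g : (forall k, (k <= n)%N -> f k = g k) ->
  count_mean n f = count_mean n g.
Proof. by move=> fg; apply: eq_mean => x; rewrite fg ?count_a_le. Qed.

(** For a path of length [n], [n - k] counts the letters [b], whose law is that of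
    the letters [a]. *)
Lemma count_mean_sym n f : count_mean n f = count_mean n (fun k => f (n - k)%N).
Proof.
elim: n f => [|n IH] f; first by rewrite /count_mean /= .
rewrite !count_meanS [X in X = _]addrC; congr (_ * _ + _ * _); rewrite IH.
  by apply: eq_count_mean => k kn; rewrite subSS.
by apply: eq_count_mean => k kn; rewrite subSn.
Qed.

(** The number of letters read is odd, which excludes ties. *)
Definition majority (n : nat) (xv : letters * F2) : bool :=
  (n < count_a n.*2.+1 xv.1 xv.2)%N.

Lemma mean_majority n v : E (fun x => (majority n (x, v))%:R) = 2^-1.
Proof.
pose f k : R := (n < k)%N%:R.
rewrite (@mean_count_a n.*2.+1 f).
have : count_mean n.*2.+1 f + count_mean n.*2.+1 f = 1.
  rewrite [X in _ + X]count_mean_sym -meanD; last 2 first.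
  - exact: bounded_measurable_count_a.
  - exact: (@bounded_measurable_count_a (fun k => f (n.*2.+1 - k)%N)).
  rewrite -[RHS](mean_cst P); apply: eq_mean => x.
  have := count_a_le n.*2.+1 x 1%g; move: (count_a _ _ _) => c cn.
  have -> : f (n.*2.+1 - c)%N = (~~ (n < c)%N)%:R.
    by rewrite /f; congr (nat_of_bool _)%:R; lia.
  rewrite /f.
  by case: (n < c)%N; rewrite ?addr0 ?add0r.
lra.
Qed.

End CountLaw.

(** * Anticoncentration of the binomial law *)

Lemma bin_central n k : ('C(n.*2, k) <= 'C(n.*2, n))%N.
Proof.
have up i : (i < n)%N -> ('C(n.*2, i) <= 'C(n.*2, i.+1))%N.
  move=> i_n; rewrite -(leq_pmul2l (m := i.+1))// mul_bin_left.
  by rewrite leq_mul2r; apply/orP; right; lia.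
have low j : (j <= n)%N -> ('C(n.*2, n - j) <= 'C(n.*2, n))%N.
  elim: j => [|j IH] jn; first by rewrite subn0.
  apply: leq_trans (IH _); last lia.
  by rewrite (_ : n - j = (n - j.+1).+1)%N; [apply: up|]; lia.
have [kn|kn] := leqP k n.
  by have := low (n - k)%N; rewrite subKn// => -> //; exact: leq_subr.
have [k2n|k2n] := leqP k n.*2; last by rewrite bin_small.
rewrite -bin_sub// (_ : n.*2 - k = n - (k - n))%N; last lia.
by apply: low; lia.
Qed.

(** This is the bound [4 ^ n / sqrt (2 n + 1)] for the central binomial
    coefficient; in this squared form it follows by induction from the ratio
    [2 (2 n + 1) / (n + 1)] of consecutive ones. *)
Lemma bin_central_sqr n : ('C(n.*2, n) ^ 2 * n.*2.+1 <= 16 ^ n)%N.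
Proof.
elim: n => [//|n IH].
have step : (n.+1 * 'C(n.+1.*2, n.+1) = 2 * n.*2.+1 * 'C(n.*2, n))%N.
  have h1 := mul_bin_diag n.*2.+2 n.
  have h2 := mul_bin_down n.*2.+1 n.
  have e1 : (n.*2.+1 - n = n.+1)%N by lia.
  rewrite doubleS; rewrite /= in h1 h2; rewrite e1 in h2.
  by rewrite -h1; nia.
rewrite -(leq_pmul2l (m := n.+1 ^ 2)) ?expn_gt0//.
rewrite mulnA -expnMn step.
move: ('C(n.*2, n)) IH => c IH.
have -> : ((2 * n.*2.+1 * c) ^ 2 * n.+1.*2.+1 =
    4 * (n.*2.+1 * n.*2.+3) * (c ^ 2 * n.*2.+1))%N by rewrite doubleS; lia.
have -> : (n.+1 ^ 2 * 16 ^ n.+1 = 4 * (n.+1 * n.+1 * 4) * 16 ^ n)%N.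
  by rewrite [in LHS](expnS 16); lia.
by apply: leq_mul => //; rewrite leq_mul2l /=; lia.
Qed.

Section Anticoncentration.
Variable R : realType.

Lemma binomial_ratio_le n k :
  ('C(n.*2.+1, k)%:R / 2 ^+ n.*2.+1 : R) <= 'C(n.*2, n)%:R / 4 ^+ n.
Proof.
have le2 : ('C(n.*2.+1, k) <= 2 * 'C(n.*2, n))%N.
  case: k => [|k]; last first.
    by rewrite binS mulSn mul1n leq_add// bin_central.
  rewrite bin0 -(bin0 n.*2); have := bin_central n 0; lia.
have -> : 4 ^+ n = 2 ^+ n.*2 :> R by rewrite -mul2n exprM; congr (_ ^+ _); ring.
rewrite exprS invfM mulrA ler_pM2r ?invr_gt0 ?exprn_gt0//.
rewrite ler_pdivrMr// mulrC -natrM ler_nat //.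
Qed.

Lemma central_ratio_sqr_le n :
  ('C(n.*2, n)%:R / 4 ^+ n : R) ^+ 2 <= n.*2.+1%:R^-1.
Proof.
rewrite expr_div_n -exprM mulnC exprM (_ : 4 ^+ 2 = 16); last by ring.
rewrite ler_pdivrMr ?exprn_gt0// mulrC ler_pdivlMr// -!natrX -natrM ler_nat.
exact: bin_central_sqr.
Qed.

End Anticoncentration.

Arguments count_a : simpl never.

(** * The majority letter is an asymptotic cluster property *)

Lemma measurable_vertex_eq d (T : measurableType d) (f g : T -> F2) :
  measurable_fun setT f -> measurable_fun setT g -> measurable [set x | f x = g x].
Proof.
move=> mf mg.
have -> : [set x | f x = g x] = \bigcup_v (f @^-1` [set v] `&` g @^-1` [set v]).
  apply/seteqP; split=> [x fg|x [v _ [/= -> ->]]//].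
  by exists (g x).
rewrite bigcup_vertex; apply: bigcup_measurable => n _.
by apply: measurableI; rewrite -[X in measurable X]setTI; [exact: mf|exact: mg].
Qed.

Lemma measurable_iter_forward n :
  measurable_fun setT (fun xv : letters * F2 => iter n (forward xv.1) xv.2).
Proof.
elim: n => [|n IH]; first exact: measurable_snd.
pose f (xv : letters * F2) := forward xv.1 xv.2.
have mf : measurable_fun setT f.
  apply: measurable_fun_sections => v.
  have -> : (fun x : letters => f (x, v)) = (fun s => v * gen s)%g \o (fun x => x v).
    by [].
  by apply: measurableT_comp => //; exact: measurable_coord.
apply: (measurableT_comp (f := f) mf (g := fun xv : letters * F2 =>
  (xv.1, iter n (forward xv.1) xv.2))).
by apply: measurable_fun_pair => //; exact: measurable_fst.
Qed.

Lemma majority_property n :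
  vertex_property (@config_shift _ letter) (majority n).
Proof.
split.
  apply: measurable_fun_sections => v.
  apply: (measurableT_comp (f := fun k => n < k)%N) => //.
  exact: measurable_count_a.
by move=> g x v; congr (_ < _)%N; exact: count_a_translate.
Qed.

(** After the paths merge they read the same letters, up to a shift of time by
    at most [K], so the two counts differ by at most [2 * K]. If they lie on
    different sides of [n], each is one of the [4 * K + 1] values within
    distance [2 * K] of [n]. *)
Lemma majority_merge n K x u v i j : (i <= K)%N -> (j <= K)%N -> (K <= n)%N ->
  iter i (forward x) u = iter j (forward x) v ->
  majority n (x, u) != majority n (x, v) ->
  exists2 k, (k < (4 * K).+1)%N & (n + k - 2 * K)%N == count_a n.*2.+1 x u.
Proof.
move=> iK jK Kn ij; rewrite /majority /=.
have cE w l : (l <= K)%N -> exists2 m, (m <= l)%N & count_a n.*2.+1 x w =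
    (m + count_a (n.*2.+1 - l) x (iter l (forward x) w))%N.
  move=> lK; exists (count_a l x w); first exact: count_a_le.
  by rewrite -count_aD; congr count_a; lia.
have [mu mui ->] := cE u i iK.
have [mv mvj ->] := cE v j jK.
rewrite ij; set z := iter j _ v.
have cz p q : (p <= K)%N -> (q <= K)%N ->
    (count_a (n.*2.+1 - p) x z <= count_a (n.*2.+1 - q) x z + K)%N.
  move=> pK qK; have [pq|qp] := leqP p q.
    rewrite (_ : n.*2.+1 - p = (n.*2.+1 - q) + (q - p))%N; last lia.
    rewrite count_aD leq_add2l; apply: leq_trans (count_a_le _ _ _) _; lia.
  apply: leq_trans (leq_addr _ _).
  rewrite (_ : n.*2.+1 - q = (n.*2.+1 - p) + (p - q))%N; last lia.
  by rewrite count_aD leq_addr.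
have := cz i j iK jK; have := cz j i jK iK.
move: (count_a _ x z) (count_a _ x z) => ci cj h1 h2 neq.
have cn : (mu + ci <= n + 2 * K)%N && (n <= mu + ci + 2 * K)%N by
  move: neq; case: (ltnP n (mu + ci)); case: (ltnP n (mv + cj)) => //= ? ? _; lia.
by exists (mu + ci + 2 * K - n)%N; [|apply/eqP]; lia.
Qed.

Section Strong.
Context (R : realType) (P : probability letters R).
Hypothesis hP : is_product_measure (@fair_coin R) P.
Local Notation E := (mean P).

(** Each of the boundedly many values in the window has probability of order
    [n^(-1/2)]. *)
Lemma window_small K (e : R) : 0 < e -> \forall n \near \oo,
  E (fun x => \sum_(k < (4 * K).+1) ((n + k - 2 * K)%N == count_a n.*2.+1 x 1%g)%:R)
    <= e.
Proof.
move=> e0; pose L : R := (4 * K).+1%:R.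
have L0 : 0 < L by [].
exists (Num.bound ((L / e) ^+ 2)) => // n /= Nn.
rewrite mean_sum; last first.
  move=> k.
  exact: (@bounded_measurable_count_a R (fun c => ((n + k - 2 * K)%N == c)%:R)).
apply: (@le_trans _ _ (\sum_(k < (4 * K).+1) (e / L))); last first.
  by rewrite sumr_const card_ord -[_ *+ _]mulr_natr divfK// gt_eqF.
apply: ler_sum => k _.
have := @count_mean_binomial R P hP n.*2.+1 (n + k - 2 * K)%N.
rewrite /count_mean => ->; apply: le_trans (binomial_ratio_le _ _ _) _.
have eL : 0 <= e / L by rewrite divr_ge0// ltW.
rewrite -(@ler_pXn2r _ 2)// ?nnegrE//.
apply: le_trans (central_ratio_sqr_le _ _) _.
rewrite -[e / L]invf_div exprVn lef_pV2 ?posrE ?exprn_gt0 ?divr_gt0//.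
apply: (@le_trans _ _ n%:R); last by rewrite ler_nat; lia.
apply: (@le_trans _ _ (Num.bound ((L / e) ^+ 2))%:R); last by rewrite ler_nat.
by apply/ltW/archi_boundP/sqr_ge0.
Qed.

(** The forward paths of [v] and of its rerooting always merge, at times that are
    finite and hence bounded with high probability. *)
Lemma merge_likely (alpha : letters * F2 -> F2) v (e : R) :
  rerooting (@config_shift _ letter) coin_map alpha -> 0 < e ->
  exists K, exists2 D : set letters, measurable D /\ (P (~` D) <= e%:E)%E &
    forall x, D x -> exists i j, [/\ (i <= K)%N, (j <= K)%N &
      iter i (forward x) v = iter j (forward x) (alpha (x, v))].
Proof.
move=> [malpha _ alpha_cl] e0.
pose M i j := [set x | iter i (forward x) v = iter j (forward x) (alpha (x, v))].
pose D K := \bigcup_(i in `I_K.+1) \bigcup_(j in `I_K.+1) M i j.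
have mM i j : measurable (M i j).
  have mit k : measurable_fun setT (fun xw : letters * F2 =>
    iter k (forward xw.1) xw.2) := measurable_iter_forward k.
  apply: measurable_vertex_eq.
    exact: (measurable_fun_section v (mit i)).
  apply: (measurableT_comp (mit j) (g := fun x => (x, alpha (x, v)))).
  apply: measurable_fun_pair => //.
  exact: measurable_fun_section.
have mD K : measurable (D K).
  by apply: bigcup_measurable => i _; exact: bigcup_measurable.
have ndD : nondecreasing_seq D.
  move=> K K' KK'; apply/subsetPset => x [i /= iK [j /= jK Mij]].
  by exists i; [exact: leq_trans iK _|exists j => //; exact: leq_trans jK _].
have DT : \bigcup_K D K = setT.
  apply/seteqP; split=> // x _.
  have [i [j ij]] := same_cluster_meet (alpha_cl x v).
  exists (maxn i j) => //; exists j; first by rewrite /= ltnS leq_maxr.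
  by exists i; [rewrite /= ltnS leq_maxl|rewrite /M /= ij].
have cvD : P \o D @ \oo --> P setT.
  by rewrite -DT; apply: nondecreasing_cvg_mu => //; rewrite DT.
have cvC : (fun K => P (~` D K)) @ \oo --> (0 : \bar R).
  have -> : (fun K => P (~` D K)) = (fun K => 1 - (P \o D) K)%E.
    by apply/funext => K; have := probability_setC P (mD K).
  rewrite -[X in _ --> X](@subee _ 1%E)//; apply: cvgeB => //.
    exact: cvg_cst.
  by rewrite -[X in _ --> X](probability_setT P).
have [K _ KP] : \forall K \near \oo, (P (~` D K) < e%:E)%E.
  have /= := cvC [set y | (y < e%:E)%E].
  apply; exact: (open_ereal_lt' _).
exists K, (D K).
  by split=> //; apply/ltW/KP => /=.
by move=> x [i /= iK [j /= jK Mij]]; exists i, j.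
Qed.

(** The two majorities can only differ if the paths have not merged within [K]
    steps or if the count of [v] falls into the window around the middle; [K]
    is chosen first, then [n]. *)
Lemma majority_asymptotic :
  asymptotic_cluster_property (@config_shift _ letter) P coin_map majority.
Proof.
split=> [n|alpha reroot v]; first exact: majority_property.
have mQ n : measurable_fun setT (majority n) by case: (majority_property n).
have [malpha _ _] := reroot.
pose b n x := majority n (x, v) == majority n (x, alpha (x, v)).
have mb n : measurable_fun setT (b n).
  have -> : b n = (fun x => if majority n (x, v) then majority n (x, alpha (x, v))
      else ~~ majority n (x, alpha (x, v))).
    by apply/funext => x; rewrite /b; case: majority; case: majority.
  have ma : measurable_fun setT (fun x => majority n (x, alpha (x, v))).
    apply: (measurableT_comp (mQ n) (g := fun x => (x, alpha (x, v)))).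
    by apply: measurable_fun_pair => //; exact: measurable_fun_section.
  apply: measurable_fun_ifT => //; first exact: measurable_fun_section.
  exact: (measurableT_comp (f := negb)).
have bE n : P [set x | majority n (x, v) = majority n (x, alpha (x, v))] =
    (E (fun x => (b n x)%:R))%:E.
  rewrite -mean_bool//; congr (P _); apply/seteqP; split=> x /=.
    by move=> h; apply/eqP.
  by move/eqP.
under eq_fun do rewrite bE.
apply: cvg_EFin; first by near=> n.
apply/cvgrPdist_le => e e0.
have e20 : 0 < e / 2 by rewrite divr_gt0.
have [K [D [mD PD] Dmerge]] := merge_likely v reroot e20.
pose c x := `[< (~` D) x >].
have mc : measurable_fun setT c by apply: measurable_set_bool; exact: measurableC.
have Ec : E (fun x => (c x)%:R) <= e / 2.
  rewrite -lee_fin -mean_bool//; apply: le_trans PD.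
  rewrite le_eqVlt; apply/orP; left; apply/eqP; congr (P _).
  by apply/seteqP; split=> x /asboolP.
pose f n m : R := \sum_(k < (4 * K).+1) ((n + k - 2 * K)%N == m)%:R.
near=> n.
have Kn : (K <= n)%N by near: n; exists K.
pose w x : R := \sum_(k < (4 * K).+1) ((n + k - 2 * K)%N == count_a n.*2.+1 x v)%:R.
have mw : bounded_measurable w by exact: (bounded_measurable_count_a (f n)).
have Ew : E w <= e / 2.
  rewrite (mean_count_a hP n.*2.+1 (f n) v); near: n.
  exact: (window_small K e20).
have bmb := bounded_measurable_bool R (mb n).
have bmc := bounded_measurable_bool R mc.
have b1 : E (fun x => (b n x)%:R) <= 1.
  rewrite -[leRHS](mean_cst P); apply: le_mean => //.
    exact: bounded_measurable_cst.
  by move=> x; case: (b n x).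
rewrite ger0_norm ?subr_ge0// lerBlDr.
apply: (@le_trans _ _ (E (fun x => ((c x)%:R + w x) + (b n x)%:R))); last first.
  rewrite !meanD//; last exact: bounded_measurableD.
  by rewrite lerD2r (splitr e) lerD.
rewrite -[leLHS](mean_cst P); apply: le_mean => //.
- exact: bounded_measurable_cst.
- by apply: bounded_measurableD => //; exact: bounded_measurableD.
move=> x; have w0 : 0 <= w x by apply: sumr_ge0.
have [bx|nbx] := boolP (b n x); first by rewrite lerDr addr_ge0.
rewrite addr0 /c; case: asboolP => [_|/contrapT Dx]; first by rewrite lerDl.
have [i [j [iK jK ij]]] := Dmerge x Dx.
have [k kK kc] := majority_merge iK jK Kn ij nbx.
rewrite add0r /w (bigD1 (Ordinal kK))//= kc lerDl; exact: sumr_ge0.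
Unshelve. all: by end_near.
Qed.

(** * Two independent paths *)

(** The vertex [a^-1 b]. Its forward path stays behind the origin, whereas the
    forward path of the origin never gets there, so that the two paths read
    independent letters. *)
Definition far_vertex : F2 := ((gen La)^-1 * gen Lb)%g.

Lemma far_vertex_behind g : ~~ behind g -> behind (far_vertex * g)%g.
Proof.
move=> gn; rewrite /behind /far_vertex -mulgA word_geninvM word_genM//.
Qed.

(** For the independent indicators [p] and [q] of the two majorities, that of
    agreement is [1 - p - q + 2 p q]. *)
Lemma majority_constant n :
  P [set x | constant_on (majority n) x
    (infinite_vertices (coin_map x) `&` [set 1%g; far_vertex])] = (2^-1)%:E.
Proof.
pose p x := majority n (x, 1%g); pose q x := majority n (x, far_vertex).
have mp v : measurable_fun setT (fun x => majority n (x, v)).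
  by apply: measurable_fun_section; case: (majority_property n).
have mpq : measurable_fun setT (fun x => p x == q x).
  have -> : (fun x => p x == q x) = (fun x => if p x then q x else ~~ q x).
    by apply/funext => x; case: (p x); case: (q x).
  apply: measurable_fun_ifT; [exact: mp|exact: mp|].
  by apply: (measurableT_comp (f := negb)) => //; exact: mp.
have -> : [set x | constant_on (majority n) x
    (infinite_vertices (coin_map x) `&` [set 1%g; far_vertex])] =
    [set x | p x == q x].
  apply/seteqP; split=> x; rewrite /constant_on /= all_infinite.
    move=> [h|h]; have h1 := h 1%g (conj I (or_introl erefl));
      have h2 := h far_vertex (conj I (or_intror erefl)).
      by rewrite /p /q h1 h2.
    by rewrite /p /q (negbTE h1) (negbTE h2).
  have [px|px] := boolP (p x) => /eqP /esym qx; [left|right] => v [_ [->|->]] //.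
  by apply/negbT.
rewrite mean_bool//; congr (_%:E).
have bp := bounded_measurable_bool R (mp 1%g).
have bq := bounded_measurable_bool R (mp far_vertex).
have bpq := bounded_measurableM bp bq.
have lmaj v : local [seq (v * g)%g | g <- positive_words n.*2.+1]
    (fun x => (majority n (x, v))%:R : R).
  by move=> x y xy; rewrite /majority /= (local_count_a xy).
have Epq : E (fun x => (p x)%:R * (q x)%:R) = 2^-1 * 2^-1.
  rewrite (mean_local_mul hP bp bq (lmaj _) (lmaj _)) ?mean_majority//.
  move=> _ /mapP[g /positive_words_behind gn ->]; apply/mapP.
  move=> -[h /positive_words_behind hn]; rewrite mul1g => gh.
  by move: gn; rewrite gh far_vertex_behind.
have -> : (fun x => (p x == q x)%:R) =
   (fun x => (1 - ((p x)%:R + (q x)%:R)) + 2 * ((p x)%:R * (q x)%:R)) :> (_ -> R).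
  by apply/funext => x; case: (p x); case: (q x) => /=; ring.
have b1 := bounded_measurable_cst letters (1 : R).
have bD := bounded_measurableD bp bq.
rewrite meanD; [|exact: bounded_measurableB|exact: bounded_measurableZ].
rewrite meanB// meanZ// Epq mean_cst meanD// !mean_majority//.
lra.
Qed.

Lemma not_strong :
  ~ strong_indistinguishability (@config_shift _ letter) P coin_map.
Proof.
move=> /(_ _ majority_asymptotic [set 1%g; far_vertex]) H.
have {}H := H (finite_set2 _ _).
have {}H : (fun=> (2^-1)%:E) @ \oo --> (1%E : \bar R).
  apply: cvg_trans H; apply: near_eq_cvg; near=> n.
  by rewrite majority_constant.
have half1 : (2^-1)%:E = 1%E :> \bar R.
  by apply: (cvg_unique _ (cvg_cst _) H).
move: half1 => -[]; lra.
Unshelve. all: by end_near.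
Qed.

End Strong.

(** * The space of configurations is standard Borel *)

(** Thanks to the left inverse, [f @` A] is the set of the [r] with [g r] in [A]
    and [f (g r) = r], a Borel set. *)
Lemma standard_borel_left_inverse (R : realType) d (X : measurableType d)
    (f : X -> R) (g : R -> X) : measurable_fun setT f -> measurable_fun setT g ->
  cancel f g -> standard_borel R X.
Proof.
move=> mf mg fK; exists f; split=> //; first exact: can_inj fK.
move=> A mA; have -> : f @` A = g @^-1` A `&` [set r | f (g r) == r].
  apply/seteqP; split=> [_ [x Ax <-] /=|r [Agr /eqP fgr]]; first by rewrite fK.
  by exists (g r).
apply: measurableI; first by rewrite -[X in measurable X]setTI; exact: mg.
apply: measurable_bool_set; apply: measurable_fun_eqr => //.
exact: measurableT_comp.
Qed.

Section Ternary.
Variable R : realType.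
Implicit Types (y : nat -> bool) (r : R).

(** Base 3 with the digits 0 and 1 only: the digits after the first contribute
    at most 1/2, so the first one is read off by comparison with 1. *)
Definition ternary_sum y n : R := \sum_(i < n) (y i)%:R / 3 ^+ i.

Definition ternary y : R := limn (ternary_sum y).

Lemma ternary_sumS y n :
  ternary_sum y n.+1 = (y 0%N)%:R + ternary_sum (fun i => y i.+1) n / 3.
Proof.
rewrite /ternary_sum big_ord_recl expr0 divr1; congr (_ + _).
by rewrite mulr_suml; apply: eq_bigr => i _; rewrite exprS invfM mulrCA mulrC.
Qed.

Lemma ternary_sum_bounds y n : 0 <= ternary_sum y n <= 3 / 2.
Proof.
elim: n y => [|n IH] y; first by rewrite /ternary_sum big_ord0; lra.
rewrite ternary_sumS; have := IH (fun i => y i.+1).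
by case: (y 0%N) => /=; lra.
Qed.

Lemma cvg_ternary y : ternary_sum y @ \oo --> ternary y.
Proof.
apply: (@nondecreasing_is_cvgn R (ternary_sum y)).
  apply/nondecreasing_seqP => n; rewrite /ternary_sum big_ord_recr lerDl.
  by rewrite divr_ge0// exprn_ge0.
by exists (3 / 2) => _ [n _ <-]; have /andP[] := ternary_sum_bounds y n.
Qed.

Lemma ternary_bounds y : 0 <= ternary y <= 3 / 2.
Proof.
have c := @cvg_ternary y; have ic := cvgP _ c.
apply/andP; split; [apply: limr_ge => //|apply: limr_le => //];
  by near=> n; have /andP[] := ternary_sum_bounds y n.
Unshelve. all: by end_near.
Qed.

Lemma ternaryE y : ternary y = (y 0%N)%:R + ternary (fun i => y i.+1) / 3.
Proof.
have c1 : (fun n => ternary_sum y n.+1) @ \oo --> ternary y.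
  by have := @cvg_ternary y; rewrite -cvg_shiftS.
apply: (cvg_unique _ c1) => //.
rewrite /mkset; under eq_fun do rewrite ternary_sumS.
apply: cvgD; first exact: cvg_cst.
by apply: cvgMr_tmp; exact: cvg_ternary.
Qed.

Definition drop_digit r : R := 3 * (r - (1 <= r)%R%:R).

Lemma ternary_digit0 y : (1 <= ternary y) = y 0%N.
Proof.
rewrite ternaryE; have := ternary_bounds (fun i => y i.+1).
by case: (y 0%N) => /= h; apply/idP; lra.
Qed.

Lemma ternary_drop y n :
  iter n drop_digit (ternary y) = ternary (fun i => y (n + i)%N).
Proof.
elim: n y => [//|n IH] y; rewrite iterSr.
have -> : drop_digit (ternary y) = ternary (fun i => y i.+1).
  by rewrite /drop_digit ternary_digit0 [ternary y]ternaryE; field.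
by rewrite IH.
Qed.

Lemma measurable_drop_digit n : measurable_fun setT (iter n drop_digit).
Proof.
elim: n => [|n IH]; first exact: measurable_id.
apply: measurableT_comp => //; apply: measurable_funM => //.
apply: measurable_funB => //.
suff [] : bounded_measurable (fun r : R => (1 <= r)%R%:R : R) by [].
by apply: bounded_measurable_bool; apply: measurable_fun_ler.
Qed.

Definition encode (x : letters) : R := ternary (fun i => x (vertex_at i) == La).

Definition decode (r : R) : letters :=
  fun g => if 1 <= iter (vertex_index g) drop_digit r then La else Lb.

Lemma encodeK : cancel encode decode.
Proof.
move=> x; apply/funext => g; rewrite /decode /encode ternary_drop ternary_digit0.
by rewrite addn0 vertex_indexK; case: (x g).
Qed.

Lemma letters_standard_borel : standard_borel R letters.
Proof.
apply: (standard_borel_left_inverse _ _ encodeK).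
  apply: (@measurable_fun_cvg _ letters R setT
    (fun n x => ternary_sum (fun i => x (vertex_at i) == La) n)); last first.
    by move=> x _; exact: cvg_ternary.
  move=> n; rewrite /ternary_sum.
  suff [] : bounded_measurable (fun x : letters =>
    \sum_(i < n) (x (vertex_at i) == La)%:R / 3 ^+ i : R) by [].
  apply: bounded_measurable_sum => i; apply: bounded_measurableM.
    exact: bounded_measurable_at.
  exact: bounded_measurable_cst.
apply: measurable_into_product => g.
apply: measurable_fun_ifT => //.
apply: measurable_fun_ler => //; exact: measurable_drop_digit.
Qed.

End Ternary.

(** * The coin-flip measure is atomless *)

Section Atomless.
Context (R : realType) (P : probability letters R).
Hypothesis hP : is_product_measure (@fair_coin R) P.

(** If [A] cannot be split, then at every coordinate it is contained, up to a null
    set, in one of the two events fixing the letter there. Intersecting [n] of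
    these events shows that [A] has probability at most [2^-n]. *)
Lemma letters_atomless : atomless P.
Proof.
move=> A mA PA0; apply: contrapT => noB.
pose C g s := [set x : letters | x g == s].
have mC g s : measurable (C g s) by apply: measurable_bool_set; exact: measurable_at.
have zero_or_full g : P (A `&` C g La) = 0%E \/ P (A `&` C g La) = P A.
  have mAC : measurable (A `&` C g La) by exact: measurableI.
  have le1 : (P (A `&` C g La) <= P A)%E.
    by apply: le_measure; rewrite ?inE.
  have [->|P0] := eqVneq (P (A `&` C g La)) 0%E; first by left.
  have [->|P1] := eqVneq (P (A `&` C g La)) (P A); first by right.
  exfalso; apply: noB; exists (A `&` C g La); split=> //.
  by rewrite lt0e P0 measure_ge0 lt_neqAle P1.
have choice g : exists s, P (A `\` C g s) = 0%E.
  have [P0|P1] := zero_or_full g.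
    exists Lb; rewrite -P0; congr (P _).
    by apply/seteqP; split=> x [Ax]; rewrite /C /=; case: (x g).
  exists La; have D : P A = (P (A `\` C g La) + P (A `&` C g La))%E :=
    measureDI P mA (mC g La).
  have mAD : measurable (A `\` C g La) by exact: measurableD.
  have [u Pu] : exists u, P (A `\` C g La) = u%:E.
    by exists (fine (P (A `\` C g La))); rewrite fineK// fin_num_measure.
  have [t Pt] : exists t, P A = t%:E.
    by exists (fine (P A)); rewrite fineK// fin_num_measure.
  by move: D; rewrite P1 Pu Pt => -[] tE; congr (_%:E); lra.
have /all_sig[t tP] g := cid (choice g).
(* Infinitely many distinct coordinates: the powers of [a]. *)
pose c i := iter i (forward (fun=> La)) 1%g.
have c_inj : injective c.
  move=> i j /(congr1 level); rewrite !level_iter => /addrI /eqP.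
  by rewrite eqr_nat => /eqP.
pose B n := box (map c (iota 0 n)) (fun g => [set t g]).
have mB n : measurable (B n) by exact: measurable_box.
have PB n : P (B n) = (2^-1 ^+ n)%:E.
  rewrite [LHS]hP//; last by rewrite map_inj_uniq ?iota_uniq.
  have half s : fair_coin R [set s] = (2^-1)%:E.
    have memE r : (r \in [set s]) = (r == s) by apply/idP/eqP; rewrite inE.
    rewrite /fair_coin !diracE !memE; case: s {memE} => /=.
      by rewrite mule0 adde0 mule1.
    by rewrite mule0 add0e mule1.
  under eq_bigr do rewrite half.
  rewrite big_map -{2}(size_iota 0 n).
  elim: (iota _ _) => [|k s IH]; first by rewrite big_nil.
  by rewrite big_cons IH exprS EFinM.
have AB n : (P A <= P (B n))%E.
  have null : P.-negligible (A `\` B n).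
    rewrite /B; elim: (map c _) => [|g F IH].
      by rewrite box_nil setDT; exact: negligible_set0.
    rewrite box_cons setDIr; apply: negligibleU => //.
    have -> : [set x : product_space F2 letter | [set t g] (x g)] = C g (t g).
      by apply/seteqP; split=> x /eqP.
    by apply/negligibleP; [exact: measurableD|exact: tP].
  have mAB : measurable (A `&` B n) by exact: measurableI.
  have D : P A = (P (A `\` B n) + P (A `&` B n))%E := measureDI P mA (mB n).
  have P0 : P (A `\` B n) = 0%E by apply/negligibleP => //; exact: measurableD.
  by rewrite D P0 add0e; apply: le_measure; rewrite ?inE.
have [p Pp] : exists p, P A = p%:E.
  by exists (fine (P A)); rewrite fineK// fin_num_measure.
rewrite Pp lte_fin in PA0.
have bound n : p * n%:R <= 1.
  have := AB n; rewrite Pp PB lee_fin exprVn -[_^-1]mul1r ler_pdivlMr ?exprn_gt0//.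
  apply: le_trans; rewrite ler_pM2l// -natrX ler_nat.
  exact/ltnW/ltn_expl.
have := bound (Num.bound p^-1).
have pb : p^-1 < (Num.bound p^-1)%:R by apply: archi_boundP; rewrite invr_ge0 ltW.
by rewrite leNgt mulrC -ltr_pdivrMr// mul1r pb.
Qed.

End Atomless.

Lemma coin_percolation (R : realType) (P : probability letters R) :
  is_product_measure (@fair_coin R) P ->
  generalized_percolation (@config_shift _ letter) P coin_map.
Proof.
move=> hP; split.
- exact: letters_standard_borel.
- exact: letters_atomless.
- exact: translate1.
- exact: translateM.
- exact: measurable_translate.
- exact: translate_preserving.
- by apply: measurable_into_product => e; exact: measurable_at.
- by [].
Qed.

Theorem theorem3p12 (R : realType) (P : probability letters R)
    (hP : is_product_measure (@fair_coin R) P) :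
  [/\ generalized_percolation (@config_shift _ letter) P coin_map,
      indistinguishability (@config_shift _ letter) P coin_map &
      ~ strong_indistinguishability (@config_shift _ letter) P coin_map].
Proof.
split; first exact: coin_percolation.
  exact: coin_indistinguishability.
exact: not_strong.
Qed.
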